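(* Let $n,d\ge 1$ be integers. Over $\mathbb{Q}$, the Schur algebra $S(n,d)$ is isomorphic to the associative $\mathbb{Q}$-algebra (with $1$) on generators $e_i,f_i$ ($1\le i\le n-1$) and $H_i$ ($1\le i\le n$) subject to the following relations (for all admissible indices $i,j,k$): \begin{align*} &\text{(R1)}\quad H_iH_j=H_jH_i;\\ &\text{(R2)}\quad e_if_j-f_je_i=\delta_{ij}(H_j-H_{j+1});\\ &\text{(R3)}\quad H_ie_j-e_jH_i=(\varepsilon_i,\alpha_j)e_j,\qquad H_if_j-f_jH_i=-(\varepsilon_i,\alpha_j)f_j;\\ &\text{(R4)}\quad e_i^2e_j-2e_ie_je_i+e_je_i^2=0\ \text{ if } |i-j|=1,\qquad e_ie_j-e_je_i=0\ \text{ otherwise};\\ &\text{(R5)}\quad f_i^2f_j-2f_if_jf_i+f_jf_i^2=0\ \text{ if } |i-j|=1,\qquad f_if_j-f_jf_i=0\ \text{ otherwise};\\ &\text{(R6)}\quad H_1+H_2+\cdots+H_n=d;\\ &\text{(R7)}\quad H_k(H_k-1)\cdots(H_k-d)=0\qquad (k=1,\dots,n). \end{align*}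
   Context: The Schur algebra is $S(n,d)=\operatorname{End}_{\Sigma_d}(V^{\otimes d})$, where $V=\mathbb{Q}^n$ and the symmetric group $\Sigma_d$ acts on $V^{\otimes d}$ by permuting the tensor places. $\{\varepsilon_1,\dots,\varepsilon_n\}$ is the standard basis of $\mathbb{Z}^n$, $(\ ,\ )$ is the bilinear form on $\mathbb{Z}^n$ with $(\varepsilon_i,\varepsilon_j)=\delta_{ij}$, and $\alpha_j=\varepsilon_j-\varepsilon_{j+1}$ for $1\le j\le n-1$. The algebra on the same generators with only the relations (R1)–(R5) is the enveloping algebra $U(\mathfrak{gl}_n)$ over $\mathbb{Q}$. *)

(* Defs.v *)
From HB Require Import structures.
From mathcomp Require Import all_boot all_order all_fingroup all_algebra.
From mathcomp Require Import generic_quotient ring_quotient boolp.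
From mathcomp Require Import finmap.
From mathcomp.multinomials Require Import monalg.

Set Implicit Arguments.
Unset Strict Implicit.
Unset Printing Implicit Defensive.

Import GRing.Theory.
Local Open Scope quotient_scope.
Local Open Scope ring_scope.

Section Ideals.
Variable A : pzRingType.

Definition two_sided_ideal (J : A -> Prop) : Prop :=
  [/\ J 0, forall x y, J x -> J y -> J (x + y)
    & forall a x b, J x -> J (a * x * b)].

Definition ideal_generated (S : A -> Prop) (x : A) : Prop :=
  forall J : A -> Prop, two_sided_ideal J -> (forall r, S r -> J r) -> J x.

Lemma ideal_generatedP S : two_sided_ideal (ideal_generated S).
Proof.
split=> [J [J0 _ _] _ // | x y Jx Jy J idJ SJ | a x b Jx J idJ SJ].
- by case: (idJ) => _ JD _; apply: JD; [apply: Jx | apply: Jy].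
- by case: (idJ) => _ _ JM; apply: JM; apply: Jx.
Qed.

Lemma ideal_generated_sub S x : S x -> ideal_generated S x.
Proof. by move=> Sx J _; apply. Qed.

End Ideals.

Definition free_algebra (K : fieldType) (I : choiceType) := {malg K[{fmonom I}]}.

Definition free_gen (K : fieldType) (I : choiceType) (i : I) :
  free_algebra K I := << fmu i >>.

(* The algebra K<I> / (S).  The zero ring is not excluded a priori, hence the
   pzRingType and lmodType structures below instead of an algType. *)
Section Presentation.
Variables (K : fieldType) (I : choiceType).
Local Notation F := (free_algebra K I).
Variable S : F -> Prop.

Definition relation_ideal : {pred F} := fun x => `[< ideal_generated S x >].

Lemma relation_idealP x : reflect (ideal_generated S x) (x \in relation_ideal).
Proof. exact: asboolP. Qed.

Lemma relation_idealM a x b :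
  x \in relation_ideal -> a * x * b \in relation_ideal.
Proof.
move=> /relation_idealP Jx; apply/relation_idealP.
by case: (ideal_generatedP S) => _ _; apply.
Qed.

Lemma relation_idealMl a x : x \in relation_ideal -> a * x \in relation_ideal.
Proof. by move=> /(relation_idealM a 1); rewrite mulr1. Qed.

Lemma relation_idealMr x b : x \in relation_ideal -> x * b \in relation_ideal.
Proof. by move=> /(relation_idealM 1 b); rewrite mul1r. Qed.

Lemma relation_ideal_zmod : zmod_closed relation_ideal.
Proof.
case: (ideal_generatedP S) => J0 JD _.
split=> [|x y Jx /(relation_idealMl (-1))]; first exact/relation_idealP.
rewrite mulN1r => Jy; apply/relation_idealP.
by apply: JD; exact/relation_idealP.
Qed.

HB.instance Definition _ :=
  GRing.isZmodClosed.Build F relation_ideal relation_ideal_zmod.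

Definition presented_algebra := @Quotient.quot F relation_ideal.
Local Notation Q := presented_algebra.

HB.instance Definition _ := GRing.Zmodule.on Q.

Definition presented_proj (x : F) : Q := \pi_(@Quotient.quot F relation_ideal) x.
Local Notation p := presented_proj.

Lemma presented_projP x y : reflect (p x = p y) (x - y \in relation_ideal).
Proof. by rewrite Quotient.idealrBE; exact: eqP. Qed.

Lemma presented_projD x y : p (x + y) = p x + p y.
Proof. exact: pi_addr. Qed.

Lemma presented_projK (x : Q) : p (repr x) = x.
Proof. exact: reprK. Qed.

Definition presented_one : Q := p 1.
Definition presented_mul (x y : Q) : Q := p (repr x * repr y).
Definition presented_scale (c : K) (x : Q) : Q := p (c *: repr x).

Lemma presented_mulE x y : presented_mul (p x) (p y) = p (x * y).
Proof.
rewrite /presented_mul; apply/presented_projP.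
set x' := repr _; set y' := repr _.
have -> : x' * y' - x * y = (x' - x) * y' + x * (y' - y).
  by rewrite mulrBl mulrBr addrA subrK.
apply: rpredD; [apply: relation_idealMr | apply: relation_idealMl];
  by apply/presented_projP; rewrite presented_projK.
Qed.

Lemma presented_scaleE c x : presented_scale c (p x) = p (c *: x).
Proof.
rewrite /presented_scale; apply/presented_projP.
rewrite -scalerBr -[_ - _]mul1r scalerAl; apply: relation_idealMl.
by apply/presented_projP; rewrite presented_projK.
Qed.

Fact presented_mulA : associative presented_mul.
Proof.
move=> x y z; rewrite -[x]presented_projK -[y]presented_projK.
by rewrite -[z]presented_projK !presented_mulE mulrA.
Qed.

Fact presented_mul1r : left_id presented_one presented_mul.
Proof. by move=> x; rewrite -[x]presented_projK presented_mulE mul1r. Qed.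

Fact presented_mulr1 : right_id presented_one presented_mul.
Proof. by move=> x; rewrite -[x]presented_projK presented_mulE mulr1. Qed.

Fact presented_mulDl : left_distributive presented_mul +%R.
Proof.
move=> x y z; rewrite -[x]presented_projK -[y]presented_projK.
rewrite -[z]presented_projK -presented_projD !presented_mulE.
by rewrite -presented_projD mulrDl.
Qed.

Fact presented_mulDr : right_distributive presented_mul +%R.
Proof.
move=> x y z; rewrite -[x]presented_projK -[y]presented_projK.
rewrite -[z]presented_projK -presented_projD !presented_mulE.
by rewrite -presented_projD mulrDr.
Qed.

HB.instance Definition _ := GRing.Zmodule_isPzRing.Build Q
  presented_mulA presented_mul1r presented_mulr1
  presented_mulDl presented_mulDr.

Fact presented_scaleA a b x :
  presented_scale a (presented_scale b x) = presented_scale (a * b) x.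
Proof. by rewrite -[x]presented_projK !presented_scaleE scalerA. Qed.

Fact presented_scale1 : left_id 1 presented_scale.
Proof. by move=> x; rewrite -[x]presented_projK presented_scaleE scale1r. Qed.

Fact presented_scaleDr : right_distributive presented_scale +%R.
Proof.
move=> a x y; rewrite -[x]presented_projK -[y]presented_projK.
by rewrite -presented_projD !presented_scaleE -presented_projD scalerDr.
Qed.

Fact presented_scaleDl x : {morph presented_scale^~ x : a b / a + b}.
Proof.
move=> a b; rewrite -[x]presented_projK !presented_scaleE.
by rewrite -presented_projD scalerDl.
Qed.

HB.instance Definition _ := GRing.Zmodule_isLmodule.Build K Q
  presented_scaleA presented_scale1 presented_scaleDr presented_scaleDl.

Lemma presented_scalerAl (c : K) (x y : Q) : c *: (x * y) = (c *: x) * y.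
Proof.
rewrite -[x]presented_projK -[y]presented_projK /GRing.mul /GRing.scale /=.
by rewrite !(presented_mulE, presented_scaleE) scalerAl.
Qed.

Lemma free_scalerAr (c : K) (x y : F) : c *: (x * y) = x * (c *: y).
Proof.
apply/malgP=> k; rewrite mcoeffZ mcoeffMl.
rewrite (mcoeffMlw _ (fsubset_refl _) (msuppZ_le c y)) mulr_sumr.
apply: eq_bigr => k1 _; rewrite mulr_sumr; apply: eq_bigr => k2 _.
by rewrite mcoeffZ mulrnAr mulrCA.
Qed.

Lemma presented_scalerAr (c : K) (x y : Q) : c *: (x * y) = x * (c *: y).
Proof.
rewrite -[x]presented_projK -[y]presented_projK /GRing.mul /GRing.scale /=.
by rewrite !(presented_mulE, presented_scaleE) free_scalerAr.
Qed.

Lemma presented_rel r : S r -> p r = 0.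
Proof.
move=> Sr; have <- : p 0 = 0 by exact: pi_zeror.
apply/presented_projP; rewrite subr0.
by apply/relation_idealP; exact: ideal_generated_sub.
Qed.

End Presentation.

Section Generators.
Variables n d : nat.

Definition ord_lo (j : 'I_n.-1) : 'I_n := widen_ord (leq_pred n) j.

Lemma ord_hi_subproof (j : 'I_n.-1) : (j.+1 < n)%N.
Proof. by rewrite -ltn_predRL. Qed.

Definition ord_hi (j : 'I_n.-1) : 'I_n := Ordinal (ord_hi_subproof j).

Definition eps (i : 'I_n) : 'rV[int]_n := delta_mx 0 i.
Definition alpha (j : 'I_n.-1) : 'rV[int]_n := eps (ord_lo j) - eps (ord_hi j).
Definition pairing (x y : 'rV[int]_n) : int := \sum_i x 0 i * y 0 i.

Definition gens : choiceType := ('I_n.-1 + 'I_n.-1 + 'I_n)%type.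
Local Notation F := (free_algebra rat gens).

Definition gen_e (i : 'I_n.-1) : F := free_gen rat (inl (inl i) : gens).
Definition gen_f (i : 'I_n.-1) : F := free_gen rat (inl (inr i) : gens).
Definition gen_H (i : 'I_n) : F := free_gen rat (inr i : gens).

Definition adjacent (i j : 'I_n.-1) : bool := (i.+1 == j) || (j.+1 == i).

Local Notation e := gen_e.
Local Notation f := gen_f.
Local Notation H := gen_H.

(* Indices are 0-based: alpha j, e j, f j for j < n - 1 and H i for i < n.
   A relation u = v is recorded as the element u - v. *)
Inductive schur_relation : F -> Prop :=
| rel_HH i j : schur_relation (H i * H j - H j * H i)
| rel_ef i j : schur_relation
    (e i * f j - f j * e i - (i == j)%:R *: (H (ord_lo j) - H (ord_hi j)))
| rel_He i j : schur_relation
    (H i * e j - e j * H i - (pairing (eps i) (alpha j))%:~R *: e j)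
| rel_Hf i j : schur_relation
    (H i * f j - f j * H i - (- (pairing (eps i) (alpha j))%:~R) *: f j)
| rel_ee_adj i j : adjacent i j -> schur_relation
    (e i ^+ 2 * e j - 2%:R *: (e i * e j * e i) + e j * e i ^+ 2)
| rel_ee_nadj i j : ~~ adjacent i j -> schur_relation (e i * e j - e j * e i)
| rel_ff_adj i j : adjacent i j -> schur_relation
    (f i ^+ 2 * f j - 2%:R *: (f i * f j * f i) + f j * f i ^+ 2)
| rel_ff_nadj i j : ~~ adjacent i j -> schur_relation (f i * f j - f j * f i)
| rel_sumH : schur_relation (\sum_(i < n) H i - d%:R)
| rel_Hpoly k : schur_relation (\prod_(0 <= m < d.+1) (H k - m%:R)).

Definition schur_presented := presented_algebra schur_relation.

HB.instance Definition _ := GRing.PzRing.on schur_presented.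
HB.instance Definition _ := GRing.Lmodule.on schur_presented.

End Generators.

Section SchurAlgebra.
Variables n d : nat.

(* The tensor power of V = Q^n in coordinates: the basis of V^{(x) d} is
   indexed by multi-indices i = (i_1, ..., i_d), and t i is the coefficient of
   v_{i_1} (x) ... (x) v_{i_d} in t. *)
Definition multi_index := {ffun 'I_d -> 'I_n}.
Definition tensor_power := {ffun multi_index -> rat^o}.

HB.instance Definition _ := Vector.on tensor_power.

Definition pure_tensor (v : 'I_d -> 'rV[rat]_n) : tensor_power :=
  [ffun i : multi_index => \prod_k v k 0 (i k)].

Definition place_perm_fun (s : 'S_d) (t : tensor_power) : tensor_power :=
  [ffun i : multi_index => t [ffun k => i ((s^-1)%g k)]].

Fact place_perm_linear s : linear (place_perm_fun s).
Proof. by move=> a t u; apply/ffunP=> i; rewrite !ffunE. Qed.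

HB.instance Definition _ s := GRing.isLinear.Build rat tensor_power tensor_power
  *:%R (place_perm_fun s) (place_perm_linear s).

Definition place_perm (s : 'S_d) : 'End(tensor_power) :=
  linfun (place_perm_fun s).

Lemma place_perm_pure s v :
  place_perm s (pure_tensor v) = pure_tensor (fun k => v (s k)).
Proof.
rewrite lfunE; apply/ffunP=> i; rewrite !ffunE (reindex_inj (@perm_inj _ s)) /=.
by apply: eq_bigr => k _; rewrite ffunE permK.
Qed.

Lemma pure_tensor_basis (t : tensor_power) :
  t = \sum_(i : multi_index) t i *: pure_tensor (fun k => delta_mx 0 (i k)).
Proof.
apply/ffunP=> j; rewrite sum_ffunE (bigD1 j) //= big1 => [|i ne_ij].
  rewrite !ffunE big1 ?addr0 => [|k _]; last by rewrite mxE !eqxx.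
  by rewrite /GRing.scale /= mulr1.
have [k ne_k]: exists k, i k != j k.
  apply/existsP; rewrite -negb_forall; apply: contra ne_ij => /forallP eq_ij.
  by apply/eqP/ffunP=> k; apply/eqP.
rewrite !ffunE (bigD1 k) //= mxE eqxx eq_sym (negPf ne_k) mul0r.
by rewrite /GRing.scale /= mulr0.
Qed.

Definition equivariant : {pred 'End(tensor_power)} := fun f =>
  [forall s : 'S_d, (f \o place_perm s)%VF == (place_perm s \o f)%VF].

Lemma equivariantP (f : 'End(tensor_power)) :
  reflect (forall s t, f (place_perm s t) = place_perm s (f t))
          (f \in equivariant).
Proof.
apply: (iffP forallP) => [fP s t | fP s].
  by have /eqP/lfunP/(_ t) := fP s; rewrite !comp_lfunE.
by apply/eqP/lfunP=> t; rewrite !comp_lfunE.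
Qed.

Fact equivariant_submod : submod_closed equivariant.
Proof.
split=> [|a f g /equivariantP fP /equivariantP gP]; apply/equivariantP=> s t.
  by rewrite !zero_lfunE linear0.
by rewrite !add_lfunE !scale_lfunE fP gP linearP.
Qed.

HB.instance Definition _ :=
  GRing.isSubmodClosed.Build rat 'End(tensor_power) equivariant
    equivariant_submod.

Record schur_algebra := SchurAlgebra {
  schur_val :> 'End(tensor_power);
  schur_valP : schur_val \in equivariant
}.

HB.instance Definition _ := [isSub for schur_val].
HB.instance Definition _ := [Choice of schur_algebra by <:].
HB.instance Definition _ := [SubChoice_isSubLmodule of schur_algebra by <:].

Fact equivariant_id : (\1%VF : 'End(tensor_power)) \in equivariant.
Proof. by apply/equivariantP=> s t; rewrite !id_lfunE. Qed.

Fact equivariant_comp (f g : 'End(tensor_power)) :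
  f \in equivariant -> g \in equivariant -> (f \o g)%VF \in equivariant.
Proof.
move=> /equivariantP fP /equivariantP gP; apply/equivariantP=> s t.
by rewrite !comp_lfunE gP fP.
Qed.

Definition schur_one := SchurAlgebra equivariant_id.
Definition schur_mul (f g : schur_algebra) :=
  SchurAlgebra (equivariant_comp (schur_valP f) (schur_valP g)).

Fact schur_mulA : associative schur_mul.
Proof. by move=> f g h; apply: val_inj; rewrite /= comp_lfunA. Qed.
Fact schur_mul1r : left_id schur_one schur_mul.
Proof. by move=> f; apply: val_inj; rewrite /= comp_lfun1l. Qed.
Fact schur_mulr1 : right_id schur_one schur_mul.
Proof. by move=> f; apply: val_inj; rewrite /= comp_lfun1r. Qed.
Fact schur_mulDl : left_distributive schur_mul +%R.
Proof. by move=> f g h; apply: val_inj; rewrite /= comp_lfunDl. Qed.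
Fact schur_mulDr : right_distributive schur_mul +%R.
Proof. by move=> f g h; apply: val_inj; rewrite /= comp_lfunDr. Qed.

HB.instance Definition _ := GRing.Zmodule_isPzRing.Build schur_algebra
  schur_mulA schur_mul1r schur_mulr1 schur_mulDl schur_mulDr.

Lemma schur_scalerAl (c : rat) (f g : schur_algebra) :
  c *: (f * g) = (c *: f) * g.
Proof. by apply: val_inj; rewrite /= comp_lfunZl. Qed.

Lemma schur_scalerAr (c : rat) (f g : schur_algebra) :
  c *: (f * g) = f * (c *: g).
Proof. by apply: val_inj; rewrite /= comp_lfunZr. Qed.

End SchurAlgebra.

(* Main.v *)
(** Let [T] be the presented algebra.  The relations (R1)-(R5) yield elements
    [E_ij] of [T] satisfying the commutation relations of [gl_n].  Define the
    normally ordered products [P(s)], for [s] a sequence of pairs [ij], by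
      [P(ij :: s) = E_ij P(s) - sum of the P(s')],
    where [s'] runs over the sequences obtained from [s] by replacing one entry
    [jl] with [il].  Then [P(s)] only depends on [s] up to permutation.

    By (R6), [\sum_k P(kk :: s) = (d - |s|) P(s)].  Together with (R7), which
    says [P(kk, ..., kk) = 0] for [d + 1] entries, this gives [P(s) = 0] for
    diagonal [s] of length greater than [d]; commuting with the [E_ij] extends
    the vanishing to all [s] of length greater than [d].  Hence the [P(s)] with
    [|s| = d] span [T].  On [V^{(x) d}] such a [P(s)] acts as the sum, over the
    permutations of the places, of the tensor products of the matrix units in
    [s].  These sums span the Schur algebra, and averaging over permutations
    inverts the map from [T]. *)
From HB Require Import structures.
Require Import Defs.
From mathcomp Require Import all_boot all_order all_fingroup all_algebra.
From mathcomp Require Import finmap zify.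
From mathcomp.multinomials Require Import monalg.
Set Implicit Arguments.
Unset Strict Implicit.
Unset Printing Implicit Defensive.
Import GRing.Theory.
Local Open Scope ring_scope.

(** * Root vectors from the Serre relations *)

Record lie_bracket (A : zmodType) (br : A -> A -> A) : Prop := LieBracket {
  brDl : forall x y z, br (x + y) z = br x z + br y z;
  brC : forall x y, br x y = - br y x;
  brJ : forall x y z, br (br x y) z = br (br x z) y + br x (br y z)
}.

Section LieBracket.
Variables (A : zmodType) (br : A -> A -> A).
Hypothesis lie : lie_bracket br.

Lemma br0l z : br 0 z = 0.
Proof. by have /eqP := brDl lie 0 0 z; rewrite addr0 -subr_eq subrr => /eqP. Qed.

Lemma brNl x z : br (- x) z = - br x z.
Proof. by apply/eqP; rewrite -addr_eq0 -(brDl lie) addNr br0l. Qed.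

Lemma brBl x y z : br (x - y) z = br x z - br y z.
Proof. by rewrite (brDl lie) brNl. Qed.

Lemma br0r z : br z 0 = 0.
Proof. by rewrite (brC lie) br0l oppr0. Qed.

Lemma brNr x z : br z (- x) = - br z x.
Proof. by rewrite (brC lie) brNl -(brC lie). Qed.

Lemma brDr x y z : br z (x + y) = br z x + br z y.
Proof.
by rewrite (brC lie) (brDl lie) opprD -!(brC lie).
Qed.

Lemma brBr x y z : br z (x - y) = br z x - br z y.
Proof. by rewrite brDr brNr. Qed.

Lemma brJr x y z : br x (br y z) = br (br x y) z + br y (br x z).
Proof.
by rewrite (brJ lie x y z) (brC lie y (br x z)) addrAC addrN add0r.
Qed.

Lemma lie_bracket_flip : lie_bracket (fun x y => br y x).
Proof.
split=> [x y z | x y | x y z]; first exact: brDr; first exact: brC.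
by rewrite brJr addrC.
Qed.

End LieBracket.

(* [root_vector br e i k] is the root vector of weight
   [alpha_i + ... + alpha_(i + k)]. *)
Fixpoint root_vector (A : Type) (br : A -> A -> A) (e : nat -> A) (i k : nat) :=
  if k is k'.+1 then br (root_vector br e i k') (e (i + k').+1) else e i.

(* The relations of [gl_n]; [e] and [f] may be extended by zero beyond their
   range, so that only the Cartan part of [ch_ef] needs a bound. *)
Record chevalley (A : zmodType) (br : A -> A -> A) (n : nat)
    (e f H : nat -> A) : Prop := Chevalley {
  ch_lie : lie_bracket br;
  ch_torsion : forall x : A, x = - x -> x = 0;
  ch_HH : forall i j, br (H i) (H j) = 0;
  ch_ef : forall i j, i != j -> br (e i) (f j) = 0;
  ch_efH : forall i, (i.+1 < n)%N -> br (e i) (f i) = H i - H i.+1;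
  ch_He : forall i j, br (H i) (e j) = e j *+ (i == j) - e j *+ (i == j.+1);
  ch_Hf : forall i j, br (H i) (f j) = f j *+ (i == j.+1) - f j *+ (i == j);
  ch_ee : forall i j, i.+1 != j -> j.+1 != i -> br (e i) (e j) = 0;
  ch_eee : forall i j, (i.+1 == j) || (j.+1 == i) -> br (e i) (br (e i) (e j)) = 0;
  ch_ff : forall i j, i.+1 != j -> j.+1 != i -> br (f i) (f j) = 0;
  ch_fff : forall i j, (i.+1 == j) || (j.+1 == i) -> br (f i) (br (f i) (f j)) = 0
}.

(** Reversing the bracket while exchanging [e] and [f] preserves all the relations, so each
    statement on positive roots also yields its negative counterpart. *)
Lemma chevalley_flip (A : zmodType) (br : A -> A -> A) n e f H :
  chevalley br n e f H -> chevalley (fun x y => br y x) n f e H.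
Proof.
case=> lie tor HH ef efH He Hf ee eee ff fff.
split=> //= [|i j ij|i j|i j|i j ij ji|i j ij|i j ij ji|i j ij].
- exact: lie_bracket_flip.
- by rewrite ef // eq_sym.
- by rewrite (brC lie) Hf opprB.
- by rewrite (brC lie) He opprB.
- by rewrite ff // eq_sym.
- by rewrite (brC lie) (brC lie (f j)) (brNr lie) opprK fff.
- by rewrite ee // eq_sym.
- by rewrite (brC lie) (brC lie (e j)) (brNr lie) opprK eee.
Qed.

Section PositiveRoots.
Variables (A : zmodType) (br : A -> A -> A) (n : nat) (e f H : nat -> A).
Hypothesis ch : chevalley br n e f H.
Local Notation X := (root_vector br e).
Let lie := ch_lie ch.

Lemma root_vector_above i k m : ((i + k).+1 < m)%N -> br (X i k) (e m) = 0.
Proof.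
elim: k => [|k IHk] lt_m /=; first by apply: (ch_ee ch); lia.
rewrite (brJ lie) IHk ?(br0l lie) ?add0r; last lia.
by rewrite (ch_ee ch) ?(br0r lie) //; lia.
Qed.

Lemma root_vector_below i k m : (m.+1 < i)%N -> br (X i k) (e m) = 0.
Proof.
move=> lt_m; elim: k => [|k IHk] /=; first by apply: (ch_ee ch); lia.
rewrite (brJ lie) IHk ?(br0l lie) ?add0r.
by rewrite (ch_ee ch) ?(br0r lie) //; lia.
Qed.

(** Beyond the rank two case, write the root vector as [[[x, y], z]]. Since [x] commutes with [z],
    this is [[x, [y, z]]], and a further bracket with [z] gives [[x, [[y, z], z]]], which vanishes
    by the Serre relation. *)
Lemma root_vector_last i k : br (X i k.+1) (e (i + k).+1) = 0.
Proof.
case: k => [|k] /=.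
  rewrite addn0 (brC lie) (brC lie (e i)) (brNr lie) (ch_eee ch) ?oppr0 //.
  by rewrite eqxx orbT.
rewrite addnS; set y := e _.+1; set z := e _.+2.
have Xz0 : br (X i k) z = 0 by apply: root_vector_above.
rewrite (brJ lie _ y) Xz0 (br0l lie) add0r.
rewrite (brJ lie _ (br y z)) Xz0 (br0l lie) add0r.
rewrite (brC lie (br y z)) (brC lie y z) !(brNr lie) opprK (ch_eee ch) ?(br0r lie) //.
by rewrite eqxx orbT.
Qed.

Lemma root_vector_first i k : br (X i k) (e i) = 0.
Proof.
elim: k => [|[|k] IHk]; first by apply: (ch_ee ch); lia.
  by rewrite /= addn0 (brC lie) (ch_eee ch) ?oppr0 ?eqxx.
rewrite [X _ _]/= -/(X i k.+1) (brJ lie) IHk ?(br0l lie) ?add0r.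
by rewrite (ch_ee ch) ?(br0r lie) //; lia.
Qed.

(** The root vectors are built by appending simple roots on the right; by the Jacobi identity,
    prepending one on the left gives the same vectors. *)
Lemma root_vector_prev i k : br (e i) (X i.+1 k) = X i k.+1.
Proof.
elim: k => [|k IHk]; first by rewrite /= addn0.
rewrite [X i.+1 _]/= (brJr lie) IHk (ch_ee ch) ?(br0r lie) ?addr0; try lia.
by rewrite addSnnS.
Qed.

(** The simple root [(i + p).+1] lies strictly inside the string. The simple vectors appended more
    than one step beyond it commute with it, which reduces the claim to [q = 0]; there the absence
    of 2-torsion decides. *)
Lemma root_vector_middle i p q : br (X i (p.+2 + q)) (e (i + p).+1) = 0.
Proof.
elim: q => [|q IHq]; last first.
  rewrite addnS [X _ _]/= -/(X i (p.+2 + q)) (brJ lie) IHq (br0l lie) add0r.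
  by rewrite (ch_ee ch) ?(br0r lie) //; lia.
rewrite addn0 /= addnS; set y := e (_ + _).+1; set z := e _.+2; set x := X i p.
have xz0 : br x z = 0 by apply: root_vector_above.
have xyy0 : br (br x y) y = 0 by exact: root_vector_last.
have yzy0 : br (br y z) y = 0.
  by rewrite (brC lie) (ch_eee ch) ?oppr0 ?eqxx.
have xyz : br (br x y) z = br x (br y z) by rewrite (brJ lie) xz0 (br0l lie) add0r.
(* By the Jacobi identity the bracket is its own opposite. *)
apply: (ch_torsion ch).
rewrite {1}xyz (brJ lie) yzy0 (br0r lie) addr0 (brJr lie) xyy0 (br0l lie) add0r.
exact: brC.
Qed.

Lemma root_vector_e i k m : br (X i k) (e m) =
  if m == (i + k).+1 then X i k.+1 else if m.+1 == i then - X m k.+1 else 0.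
Proof.
case: eqP => [-> //|/eqP ne_m]; case: eqP => [<-|/eqP ne_i].
  by rewrite (brC lie) root_vector_prev.
have [lt_m|le_m] := ltnP (i + k).+1 m; first exact: root_vector_above.
have [lt_i|le_i] := ltnP m.+1 i; first exact: root_vector_below.
have [-> |ne_mi] := eqVneq m i; first exact: root_vector_first.
(* Now [i < m <= i + k], so [m] is either the last simple root of the string or an interior one. *)
have [p Dm] : exists p, m = (i + p).+1 by exists (m - i.+1)%N; lia.
have [k' Dk]: exists k', k = k'.+1 by exists k.-1; lia.
have [eq_pk|ne_pk] := eqVneq p k'.
  by rewrite Dm Dk eq_pk; apply: root_vector_last.
have [q Dq] : exists q, k = (p.+2 + q)%N by exists (k - p.+2)%N; lia.
by rewrite Dq Dm root_vector_middle.
Qed.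

Lemma root_vector_H m i k : br (H m) (X i k) =
  X i k *+ (m == i) - X i k *+ (m == (i + k).+1).
Proof.
elim: k => [|k IHk]; first by rewrite (ch_He ch) addn0.
rewrite [X i _]/= (brJr lie) IHk (ch_He ch) (brBr lie) (brBl lie) addnS.
set x := X i k; set y := e _.
have mul0 u v (b : bool) : br (u *+ b) v = br u v *+ b.
  by case: b; rewrite ?(br0l lie).
have mul1 u v (b : bool) : br u (v *+ b) = br u v *+ b.
  by case: b; rewrite ?(br0r lie).
by rewrite !mul0 !mul1 addrA subrK.
Qed.

(** Subtracting a simple root from a string leaves a root only at its two ends, and the two ends
    come with opposite signs. *)
Lemma root_vector_f i k m : ((i + k).+2 < n)%N -> br (X i k.+1) (f m) =
  X i k *+ (m == (i + k).+1) - X i.+1 k *+ (m == i).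
Proof.
elim: k => [|k IHk] lt_n.
  rewrite addn0 /= addn0 (brJ lie).
  have [->|ne_i] := eqVneq m i.
    rewrite (ch_efH ch); last lia.
    rewrite (ch_ef ch (i := i.+1)) ?(br0r lie) ?addr0; last lia.
    rewrite (brBl lie) !(ch_He ch) !eqxx.
    have -> : (i == i.+1) = false by lia.
    have -> : (i == i.+2) = false by lia.
    have -> : (i.+1 == i.+2) = false by lia.
    by rewrite !subr0 !mulr0n !sub0r.
  rewrite (ch_ef ch (i := i)) 1?eq_sym // (br0l lie) add0r mulr0n subr0.
  have [->|ne_i1] := eqVneq m i.+1; last first.
    by rewrite (ch_ef ch) 1?eq_sym // (br0r lie).
  rewrite (ch_efH ch); last lia.
  rewrite (brC lie) (brBl lie) !(ch_He ch) !eqxx.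
  have -> : (i.+1 == i) = false by lia.
  have -> : (i.+2 == i) = false by lia.
  have -> : (i.+2 == i.+1) = false by lia.
  by rewrite subr0 mulr0n !sub0r subr0 opprK.
rewrite [X i k.+2]/= -/(X i k.+1) addnS (brJ lie) IHk; last by move: lt_n; lia.
have -> : br (X i k *+ (m == (i + k).+1) - X i.+1 k *+ (m == i)) (e (i + k).+2) =
          - X i.+1 k.+1 *+ (m == i).
  rewrite (brBl lie) [X i.+1 k.+1]/= addSn.
  have -> : br (X i k *+ (m == (i + k).+1)) (e (i + k).+2) = 0.
    by case: eqP => _; rewrite ?(br0l lie) // root_vector_above.
  by rewrite sub0r; case: eqP => _; rewrite ?(br0l lie) ?oppr0.
have [->|ne_m] := eqVneq m (i + k).+2; last first.
  by rewrite (ch_ef ch) 1?eq_sym // (br0r lie) addr0 add0r mulNrn.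
(* [X i k.+1] has weight [eps_i - eps_m] with [m = (i + k).+2], so its bracket with [H m - H m.+1]
   is [X i k.+1] itself. *)
rewrite (ch_efH ch); last by move: lt_n; lia.
rewrite (brBr lie) !(brC lie _ (H _)) !root_vector_H.
have -> : ((i + k).+2 == i) = false by lia.
have -> : ((i + k).+3 == i) = false by lia.
have -> : ((i + k).+3 == (i + k.+1).+1) = false by lia.
have -> : ((i + k).+2 == (i + k.+1).+1) by lia.
by rewrite !mulr0n !subr0 oppr0 sub0r opprK add0r subr0.
Qed.

End PositiveRoots.

(** * All commutation relations of [gl_n] *)

Definition gl_relation (A : zmodType) (br : A -> A -> A) (n : nat)
    (E : nat -> nat -> A) (k l : nat) : Prop :=
  forall i j, (i < n)%N -> (j < n)%N ->
    br (E i j) (E k l) = E i l *+ (j == k) - E k j *+ (l == i).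

(** [E k l] is the bracket of [E k m] and [E m l], and bracketing with [E i j] is a derivation. This
    is why [gl_relation] fixes [k] and [l] and quantifies over [i] and [j]. *)
Lemma gl_relation_trans (A : zmodType) (br : A -> A -> A) n E k m l :
    lie_bracket br -> (k < n)%N -> (m < n)%N -> (l < n)%N -> k != l ->
  gl_relation br n E k m -> gl_relation br n E m l -> gl_relation br n E k l.
Proof.
move=> lie ltk ltm ltl kl Ekm Eml i j lti ltj.
have <- : br (E k m) (E m l) = E k l.
  by rewrite Eml // eqxx [l == k]eq_sym (negPf kl) subr0.
have mulnl u v (b : bool) : br (u *+ b) v = br u v *+ b.
  by case: b; rewrite ?(br0l lie).
have mulnr u v (b : bool) : br u (v *+ b) = br u v *+ b.
  by case: b; rewrite ?(br0r lie).
rewrite (brJr lie) Ekm // Eml // (brBl lie) (brBr lie) !mulnl !mulnr.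
rewrite ![br (E k m) _](brC lie) !Ekm // !Eml // !eqxx.
rewrite [l == k]eq_sym (negPf kl) !mulr0n !subr0 !sub0r !opprK !opprB.
rewrite [E k l *+ _ *+ _]mulrnAC addrA subrK.
case: (l == i); case: (j == k); rewrite ?mulr0n ?mulr1n ?subr0 ?sub0r ?addr0 //.
by rewrite opprB addrA subrK.
Qed.

(** Below the diagonal the bracket is reversed because [E_ki = [E_kj, E_ji]] for [i < j < k],
    whereas above it [E_ik = [E_ij, E_jk]]. *)
Definition root_element (A : Type) (br : A -> A -> A) (e f H : nat -> A)
    (i j : nat) : A :=
  if (i < j)%N then root_vector br e i (j - i).-1
  else if (j < i)%N then root_vector (fun x y => br y x) f j (i - j).-1
  else H i.

Lemma root_element_flip (A : Type) (br : A -> A -> A) e f H i j :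
  root_element (fun x y => br y x) f e H i j = root_element br e f H j i.
Proof. by rewrite /root_element; case: ltngtP => // ->. Qed.

Lemma chevalley_gl_e (A : zmodType) (br : A -> A -> A) n e f H m :
    chevalley br n e f H -> (m.+1 < n)%N ->
  gl_relation br n (root_element br e f H) m m.+1.
Proof.
move=> ch ltm i j lti ltj; have lie := ch_lie ch.
have Em : root_element br e f H m m.+1 = e m.
  by rewrite /root_element ltnSn subSnn.
rewrite Em {1}/root_element; case: ltngtP => [ij|ji|<-{j ltj}].
- have Dj : (i + (j - i).-1).+1 = j by lia.
  rewrite (root_vector_e ch) Dj [j == m]eq_sym; have [->|ne_m] := eqVneq m j.
    have -> : (j.+1 == i) = false by lia.
    by rewrite /root_element leqW // subr0 mulr1n; congr root_vector; lia.
  rewrite sub0r; have [Di|//] := eqVneq m.+1 i; last by rewrite oppr0.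
  rewrite -Di /root_element (_ : m < j)%N; last lia.
  by rewrite mulr1n; congr (- root_vector _ _ _ _); lia.
- rewrite (brC lie); have [Di|ne_i] := eqVneq i j.+1.
    rewrite Di subSnn /=; have [<-|ne_m] := eqVneq j m.
      rewrite eqxx (ch_efH ch) ?opprB //; last by rewrite -Di.
      by rewrite /root_element !ltnn.
    have -> : (m.+1 == j.+1) = false by lia.
    by rewrite (ch_ef ch) ?subrr ?oppr0 // eq_sym.
  have [k Di] : exists k, i = (j + k).+2 by exists (i - j.+2)%N; lia.
  have -> : (i - j).-1 = k.+1 by lia.
  rewrite (root_vector_f (chevalley_flip ch)) -?Di // opprB; congr (_ - _).
    rewrite [j == m]eq_sym; have [->|//] := eqVneq m j.
    rewrite !mulr1n /root_element ltnNge ltnW /=; last lia.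
    by rewrite (_ : j.+1 < i)%N; last lia; congr root_vector; lia.
  rewrite Di eqSS; have [->|//] := eqVneq m _.
  rewrite !mulr1n /root_element ltnNge ltnW /=; last lia.
  by rewrite (_ : j < (j + k).+1)%N; last lia; congr root_vector; lia.
- rewrite (ch_He ch) [m.+1 == i]eq_sym; congr (_ - _).
    by have [->|//] := eqVneq i m; rewrite -Em.
  by have [->|//] := eqVneq i m.+1; rewrite Em.
Qed.

Lemma chevalley_gl_f (A : zmodType) (br : A -> A -> A) n e f H m :
    chevalley br n e f H -> (m.+1 < n)%N ->
  gl_relation br n (root_element br e f H) m.+1 m.
Proof.
move=> ch ltm i j lti ltj; rewrite (brC (ch_lie ch)) -!(root_element_flip br).
have -> := chevalley_gl_e (chevalley_flip ch) ltm ltj lti.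
by rewrite opprB [i == m]eq_sym [m.+1 == j]eq_sym.
Qed.

Lemma chevalley_gl_H (A : zmodType) (br : A -> A -> A) n e f H m :
    chevalley br n e f H -> gl_relation br n (root_element br e f H) m m.
Proof.
move=> ch i j lti ltj; have lie := ch_lie ch.
have Em : root_element br e f H m m = H m by rewrite /root_element ltnn.
rewrite Em (brC lie) {1}/root_element; case: ltngtP => [ij|ji|eq_ij].
- rewrite (root_vector_H ch) opprB.
  have -> : (i + (j - i).-1).+1 = j by lia.
  have <- : root_element br e f H i j = root_vector br e i (j - i).-1.
    by rewrite /root_element ij.
  by congr (_ - _); rewrite 1?eq_sym; case: eqP => // ->.
- rewrite -(brC lie) (root_vector_H (chevalley_flip ch)).
  have -> : (j + (i - j).-1).+1 = i by lia.
  have <- : root_element br e f H i j =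
            root_vector (fun x y => br y x) f j (i - j).-1.
    by rewrite /root_element ltnNge ltnW //= ji.
  by congr (_ - _); rewrite 1?eq_sym; case: eqP => // ->.
- rewrite (ch_HH ch) oppr0 -eq_ij [m == i]eq_sym.
  by have [->|_] := eqVneq i m; rewrite subrr.
Qed.

(** Induction on the distance between [k] and [l]: the simple root vectors and the diagonal are
    known, and [gl_relation_trans] adds one simple root at a time. *)
Lemma chevalley_gl (A : zmodType) (br : A -> A -> A) n e f H k l :
    chevalley br n e f H -> (k < n)%N -> (l < n)%N ->
  gl_relation br n (root_element br e f H) k l.
Proof.
move=> ch ltk ltl; have lie := ch_lie ch.
have [kl|lk|<-] := ltngtP k l; last exact: chevalley_gl_H.
  have [p Dl] : exists p, l = (k + p).+1 by exists (l - k.+1)%N; lia.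
  rewrite {}Dl {l kl} in ltl *; elim: p => [|p IHp] in ltl *.
    by rewrite addn0 in ltl *; apply: chevalley_gl_e.
  apply: (gl_relation_trans (m := (k + p).+1)) => //; try lia.
    by apply: IHp; lia.
  by rewrite addnS; apply: (chevalley_gl_e ch); lia.
have [p Dk] : exists p, k = (l + p).+1 by exists (k - l.+1)%N; lia.
rewrite {}Dk {k lk} in ltk *; elim: p => [|p IHp] in ltk *.
  by rewrite addn0 in ltk *; apply: chevalley_gl_f.
apply: (gl_relation_trans (m := (l + p).+1)) => //; try lia.
  by rewrite addnS; apply: (chevalley_gl_f ch); lia.
by apply: IHp; lia.
Qed.

(** * Normally ordered products *)

Section Replace.
Variables (T : eqType) (Z : zmodType).
Implicit Types (g h : T -> option T) (F G : seq T -> Z) (s u : seq T).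

(* The sum of [F u] over the sequences [u] obtained from [s] by replacing a
   single entry [y] with [g y]; entries with [g y = None] are skipped. *)
Fixpoint replace_sum g F s : Z :=
  if s is y :: s' then
    oapp (fun z => F (z :: s')) 0 (g y) + replace_sum g (fun u => F (y :: u)) s'
  else 0.

Lemma eq_replace_sum g h F G s :
    g =1 h -> (forall u, size u = size s -> F u = G u) ->
  replace_sum g F s = replace_sum h G s.
Proof.
move=> gh; elim: s F G => //= y s IHs F G FG; rewrite gh.
congr (_ + _); last by apply: IHs => u /= size_u; rewrite FG /= ?size_u.
by case: (h y) => //= z; rewrite FG.
Qed.

Lemma replace_sum0 g s : replace_sum g (fun=> 0) s = 0.
Proof. by elim: s => //= y s ->; case: (g y) => [z|] /=; rewrite ?addr0. Qed.

Lemma replace_sumNone F s : replace_sum (fun=> None) F s = 0.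
Proof. by elim: s F => //= y s IHs F; rewrite IHs add0r. Qed.

Lemma replace_sumD g F G s :
  replace_sum g (fun u => F u + G u) s = replace_sum g F s + replace_sum g G s.
Proof.
elim: s F G => [|y s IHs] F G /=; rewrite ?addr0 // IHs addrACA.
by case: (g y) => [z|] /=; rewrite ?add0r ?addr0.
Qed.

Lemma replace_sumN g F s :
  replace_sum g (fun u => - F u) s = - replace_sum g F s.
Proof.
elim: s F => [|y s IHs] F /=; rewrite ?oppr0 // IHs opprD.
by case: (g y) => [z|] /=; rewrite ?oppr0.
Qed.

Lemma replace_sumB g F G s :
  replace_sum g (fun u => F u - G u) s = replace_sum g F s - replace_sum g G s.
Proof. by rewrite replace_sumD replace_sumN. Qed.

Lemma replace_sum_sum (I : Type) (r : seq I) (p : pred I) g (F : I -> seq T -> Z) s :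
  replace_sum g (fun u => \sum_(i <- r | p i) F i u) s =
  \sum_(i <- r | p i) replace_sum g (F i) s.
Proof.
elim: r => [|i r IHr].
  rewrite big_nil; transitivity (replace_sum g (fun=> 0) s).
    by apply: eq_replace_sum => // u _; rewrite big_nil.
  exact: replace_sum0.
rewrite big_cons -IHr; case pi: (p i); last first.
  by apply: eq_replace_sum => // u _; rewrite big_cons pi.
by rewrite -replace_sumD; apply: eq_replace_sum => // u _; rewrite big_cons pi.
Qed.

Lemma replace_sum_oapp (f : T -> seq T -> Z) g o s :
  replace_sum g (fun u => oapp (fun z => f z u) 0 o) s =
  oapp (fun z => replace_sum g (f z) s) 0 o.
Proof. by case: o => //=; rewrite replace_sum0. Qed.

(** Replacements at two distinct entries commute. The correction term on each side supplies the
    double replacements of one entry that occur on the other side. *)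
Lemma replace_sumC g h F s :
  replace_sum g (replace_sum h F) s + replace_sum (fun y => obind g (h y)) F s =
  replace_sum h (replace_sum g F) s + replace_sum (fun y => obind h (g y)) F s.
Proof.
elim: s F => [|y s IHs] F //=.
have step g1 g2 :
    oapp (fun z => oapp (fun w => F (w :: s)) 0 (g2 z) +
                   replace_sum g2 (fun u => F (z :: u)) s) 0 (g1 y) =
    oapp (fun w => F (w :: s)) 0 (obind g2 (g1 y)) +
    oapp (fun z => replace_sum g2 (fun u => F (z :: u)) s) 0 (g1 y).
  by case: (g1 y) => [z|] /=; rewrite ?addr0.
rewrite !step !replace_sumD !replace_sum_oapp.
set a := oapp _ _ _; set b := oapp _ _ _; set c := oapp _ _ _; set d := oapp _ _ _.
rewrite [LHS](AC (2*2*2) (1*2*3*5*(4*6))) [RHS](AC (2*2*2) (5*3*2*1*(4*6))).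
by congr (_ + _); apply: (IHs (fun u => F (y :: u))).
Qed.

(** The prefix [p] collects the entries already passed. Invariance of [F] is assumed only in the
    relevant length, so that the lemma can serve inside an induction on length that establishes this
    invariance. *)
Lemma replace_sum_pick g F p s :
    (forall u v, size u = size (p ++ s) -> perm_eq u v -> F u = F v) ->
  replace_sum g (fun u => F (p ++ u)) s =
  \sum_(y <- s) oapp (fun z => F (z :: p ++ rem y s)) 0 (g y).
Proof.
elim: s p => [|y s IHs] p permF /=; first by rewrite big_nil.
have perm_mid q z w : perm_eq (q ++ z :: w) (z :: q ++ w).
  by rewrite -cat1s perm_catCA.
rewrite big_cons eqxx; congr (_ + _).
  case: (g y) => //= z; apply: permF => //.
  by rewrite !size_cat.
have permF' u v : size u = size (rcons p y ++ s) -> perm_eq u v -> F u = F v.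
  by rewrite cat_rcons; apply: permF.
rewrite (eq_replace_sum (h := g) (G := fun u => F (rcons p y ++ u))) //; last first.
  by move=> u _; rewrite cat_rcons.
rewrite IHs //; apply: eq_big_seq => x xs.
case: (g x) => //= z; apply: permF'.
  by rewrite /= !size_cat size_rcons size_rem //=; case: (s) xs => //= *; lia.
rewrite perm_cons cat_rcons; case: eqVneq => [->|ne_yx]; last by [].
by rewrite perm_cat2l perm_sym perm_to_rem.
Qed.

Lemma replace_sum_perm g F s t :
    (forall u v, size u = size s -> perm_eq u v -> F u = F v) ->
  perm_eq s t -> replace_sum g F s = replace_sum g F t.
Proof.
move=> permF st.
rewrite (@replace_sum_pick g F [::] s) // (@replace_sum_pick g F [::] t); last first.
  by move=> u v size_u; apply: permF; rewrite size_u (perm_size st).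
rewrite (perm_big _ st); apply: eq_big_seq => y yt.
case: (g y) => //= z; apply: permF.
  by rewrite /= size_rem ?(perm_mem st) //; case: (s) (perm_size st) yt => //; case: (t).
have ys : y \in s by rewrite (perm_mem st).
by rewrite perm_cons -(perm_cons y) -(permPl (perm_to_rem ys)) -(permPr (perm_to_rem yt)).
Qed.

End Replace.

Lemma replace_sum_mull (T : eqType) (A : pzRingType) (g : T -> option T) a
    (F : seq T -> A) s :
  replace_sum g (fun u => a * F u) s = a * replace_sum g F s.
Proof.
elim: s F => [|y s IHs] F /=; rewrite ?mulr0 // IHs mulrDr.
by case: (g y) => [z|] /=; rewrite ?mulr0.
Qed.

Lemma replace_sum_mulr (T : eqType) (A : pzRingType) (g : T -> option T) a
    (F : seq T -> A) s :
  replace_sum g (fun u => F u * a) s = replace_sum g F s * a.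
Proof.
elim: s F => [|y s IHs] F /=; rewrite ?mul0r // IHs mulrDl.
by case: (g y) => [z|] /=; rewrite ?mul0r.
Qed.

(* The product of the matrix units indexed by [x] and [y], [None] being 0. *)
Definition unit_mul n (x y : 'I_n * 'I_n) : option ('I_n * 'I_n) :=
  if x.2 == y.1 then Some (x.1, y.2) else None.

Lemma unit_mulA n (x y z : 'I_n * 'I_n) :
  obind (unit_mul x) (unit_mul y z) = obind (fun w => unit_mul w z) (unit_mul x y).
Proof.
rewrite /unit_mul; case: (eqVneq y.2 z.1) => yz; case: (eqVneq x.2 y.1) => xy /=;
  by rewrite ?xy ?yz ?eqxx ?(negPf xy) ?(negPf yz).
Qed.

(** * Symmetry and commutation rules of normally ordered products *)

Section NormalOrdering.
Variables (A : pzRingType) (n : nat) (E : 'I_n * 'I_n -> A).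
Implicit Types (x y z : 'I_n * 'I_n) (s t u : seq ('I_n * 'I_n)).

(** The recursion visits modified copies of the tail, which are not subterms; hence the fuel [m].
    With [m = size s] it runs out exactly at the empty sequence. *)
Fixpoint normal_rec m s : A :=
  match m, s with
  | m'.+1, x :: s' =>
      E x * normal_rec m' s' - replace_sum (unit_mul x) (normal_rec m') s'
  | _, _ => 1
  end.

(* If [E_ij] acts as the differential operator [\sum_a x_ia d/dx_ja], then
   [normal s] is the normally ordered product of the [E_ij] for [ij] in [s]. *)
Definition normal s : A := normal_rec (size s) s.

Lemma normal_cons x s :
  normal (x :: s) = E x * normal s - replace_sum (unit_mul x) normal s.
Proof.
rewrite /normal /=; congr (_ - _).
by apply: eq_replace_sum => // u ->.
Qed.

Lemma mul_normal x s :
  E x * normal s = normal (x :: s) + replace_sum (unit_mul x) normal s.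
Proof. by rewrite normal_cons subrK. Qed.

Local Arguments normal : simpl never.

Hypothesis glE : forall x y, E x * E y - E y * E x =
  oapp E 0 (unit_mul x y) - oapp E 0 (unit_mul y x).

(** Expanding both entries leaves three groups of terms, each symmetric in [x] and [y]: the first by
    [glE], the second visibly, and the third by [replace_sumC]. *)
Lemma normal_swap x y s : normal (x :: y :: s) = normal (y :: x :: s).
Proof.
have expand a b : normal (a :: b :: s) =
    (E a * E b - oapp E 0 (unit_mul a b)) * normal s
    - (E a * replace_sum (unit_mul b) normal s
       + E b * replace_sum (unit_mul a) normal s)
    + (replace_sum (unit_mul a) (replace_sum (unit_mul b) normal) s
       + replace_sum (fun z => obind (unit_mul a) (unit_mul b z)) normal s).
  have head : oapp (fun z => normal (z :: s)) 0 (unit_mul a b) =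
      oapp E 0 (unit_mul a b) * normal s
      - replace_sum (fun z => obind (unit_mul a) (unit_mul b z)) normal s.
    rewrite (eq_replace_sum (G := normal)
      (h := fun z => obind (fun w => unit_mul w z) (unit_mul a b))) => // [|z].
      case: (unit_mul a b) => [z|] /=; rewrite ?normal_cons //.
      by rewrite replace_sumNone mul0r subr0.
    exact: unit_mulA.
  rewrite normal_cons /= head normal_cons.
  rewrite (eq_replace_sum (h := unit_mul a) (s := s) (F := fun u => normal (b :: u))
    (G := fun u => E b * normal u - replace_sum (unit_mul b) normal u)) => // [|u _].
    rewrite replace_sumB replace_sum_mull mulrBr mulrBl mulrA !opprD !opprK.
    by rewrite !addrA [LHS](ACl (1*3*2*5*6*4)).
  exact: normal_cons.
rewrite !expand replace_sumC; congr (_ - _ + _); last exact: addrC.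
congr (_ * _); apply/eqP; rewrite subr_eq addrAC -addrA -glE.
by rewrite [_ - _ * _]addrC addrA subrr add0r.
Qed.

(** Strong induction on the length. If the heads differ, both tails are rearranged to bring the
    other head to second position, and [normal_swap] exchanges the first two entries. *)
Lemma perm_normal s t : perm_eq s t -> normal s = normal t.
Proof.
have [m] := ubnP (size s); elim: m s t => // m IHm [|x s] [|y t] //=.
- by move=> _ /perm_size/eqP.
- by move=> _ /perm_size/eqP.
rewrite ltnS => lt_s st.
have tail z u v : (size u < m)%N -> perm_eq u v ->
    normal (z :: u) = normal (z :: v).
  move=> lt_u uv; rewrite !normal_cons (IHm _ _ lt_u uv).
  congr (_ - _); apply: replace_sum_perm => // u' v' size_u'.
  by apply: IHm; rewrite size_u'.
have [eq_xy|ne_xy] := eqVneq x y.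
  by rewrite -eq_xy perm_cons in st *; apply: tail.
have ys : y \in s.
  by have:= perm_mem st y; rewrite !inE eqxx eq_sym (negPf ne_xy).
have xt : x \in t.
  by have:= perm_mem st x; rewrite !inE eqxx (negPf ne_xy).
have lt_r : ((size (rem y s)).+1 < m)%N.
  by rewrite size_rem //; case: (s) ys lt_s.
have s_r := perm_to_rem ys; have t_r := perm_to_rem xt.
have rem_st : perm_eq (rem y s) (rem x t).
  rewrite -(perm_cons y) -(perm_cons x).
  rewrite -(permPr (_ : perm_eq (y :: x :: rem x t) _)); last first.
    by rewrite -cat1s -(cat1s x) perm_catCA.
  have := st; rewrite -(perm_cons x) perm_sym => _.
  have xs : perm_eq (x :: s) (x :: y :: rem y s) by rewrite perm_cons.
  have yt : perm_eq (y :: t) (y :: x :: rem x t) by rewrite perm_cons.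
  by rewrite -(permPl xs) -(permPr yt).
rewrite (tail x s (y :: rem y s)) // normal_swap.
rewrite (tail y t (x :: rem x t)) //; last first.
  by have [eq_st] := perm_size st; rewrite -eq_st.
by apply: tail; rewrite ?perm_cons // ltnS -ltnS.
Qed.

(** The mirror image of [mul_normal]. In the induction [normal_swap] carries [x] past the head, and
    left and right replacements commute because [unit_mul] is associative. *)
Lemma normal_mul s x :
  normal s * E x = normal (x :: s) + replace_sum (fun y => unit_mul y x) normal s.
Proof.
have [m] := ubnP (size s); elim: m s => // m IHm [_|y s].
  by rewrite normal_cons /= mulr1 mul1r subr0 addr0.
rewrite ltnS => lt_s; rewrite normal_cons mulrBl -mulrA IHm // -replace_sum_mulr.
set Lx := replace_sum _ normal s.
rewrite (eq_replace_sum (g := unit_mul y) (h := unit_mul y)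
  (F := fun u => normal u * E x) (s := s)
  (G := fun u => normal (x :: u) + replace_sum (fun y => unit_mul y x) normal u))
  => // [|u size_u]; last by apply: IHm; rewrite size_u.
rewrite normal_swap (normal_cons y (x :: s)) /= replace_sumD mulrDr !opprD -!addrA.
congr (_ + _).
have -> : replace_sum (fun y => unit_mul y x) (fun u => normal (y :: u)) s =
  E y * Lx - replace_sum (unit_mul y) (replace_sum (fun y => unit_mul y x) normal) s.
  have := replace_sumC (unit_mul y) (fun y => unit_mul y x) normal s.
  rewrite (eq_replace_sum (h := fun z => obind (fun y => unit_mul y x) (unit_mul y z))
     (F := normal) (G := normal)) // => [/addIr->|z]; last by rewrite unit_mulA.
  rewrite -replace_sum_mull -replace_sumB; apply: eq_replace_sum => // u _.
  exact: normal_cons.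
by rewrite [RHS]addrCA addKr addrCA.
Qed.

Lemma normal_ad x s :
  E x * normal s - normal s * E x =
  replace_sum (unit_mul x) normal s - replace_sum (fun y => unit_mul y x) normal s.
Proof. by rewrite mul_normal normal_mul opprD addrACA subrr add0r. Qed.

Lemma replace_sum_normal g s :
  replace_sum g normal s = \sum_(y <- s) oapp (fun z => normal (z :: rem y s)) 0 (g y).
Proof.
by apply: (@replace_sum_pick _ _ g normal [::]) => u v _; apply: perm_normal.
Qed.

End NormalOrdering.

(** * Vanishing of the normally ordered products longer than [d] *)

Section Vanishing.
Variables (A : pzRingType) (n d : nat) (E : 'I_n * 'I_n -> A).
Implicit Types (x y z : 'I_n * 'I_n) (s t u : seq ('I_n * 'I_n)).
Local Notation normal := (normal E).

Hypothesis torsion_free : forall (a : A) m, a *+ m.+1 = 0 -> a = 0.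
Hypothesis glE : forall x y, E x * E y - E y * E x =
  oapp E 0 (unit_mul x y) - oapp E 0 (unit_mul y x).
Hypothesis sumE : \sum_k E (k, k) = d%:R.
Hypothesis polyE : forall k, \prod_(0 <= m < d.+1) (E (k, k) - m%:R) = 0.

Definition diagonal s := all (fun y => y.1 == y.2) s.

(** The diagonal matrix units sum to the identity matrix, so each entry of [s] contributes one
    unchanged copy of [s]. *)
Lemma sum_replace_diag (F : seq ('I_n * 'I_n) -> A) s :
  \sum_k replace_sum (unit_mul (k, k)) F s = F s *+ size s.
Proof.
elim: s F => [|y s IHs] F /=; first by rewrite big1.
rewrite big_split IHs mulrS; congr (_ + _).
rewrite (bigD1 y.1) //= /unit_mul /= eqxx /= -surjective_pairing big1 ?addr0 //.
by move=> k /negPf->.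
Qed.

Lemma replace_diag_diag (F : seq ('I_n * 'I_n) -> A) k s :
  diagonal s ->
  replace_sum (unit_mul (k, k)) F s = F s *+ count_mem (k, k) s.
Proof.
elim: s F => //= -[i j] s IHs F /= /andP[/eqP<-{j} diag_s]; rewrite IHs //.
rewrite /unit_mul /= [(i, i) == _]xpair_eqE andbb eq_sym.
by case: eqVneq => [->|]; rewrite ?mulrDr ?mulrnDr ?mulr1n ?add0r.
Qed.

(** Obtained by multiplying [normal s] by relation (R6). The additive form stays valid when [size s]
    exceeds [d]. *)
Lemma sum_normal_diag s :
  \sum_k normal ((k, k) :: s) + normal s *+ size s = normal s *+ d.
Proof.
rewrite -sum_replace_diag -big_split /=.
under eq_bigr do rewrite -mul_normal.
by rewrite -mulr_suml sumE mulr_natl.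
Qed.

Lemma normal_diag_cons k s : diagonal s ->
  normal ((k, k) :: s) = (E (k, k) - (count_mem (k, k) s)%:R) * normal s.
Proof. by move=> ds; rewrite normal_cons replace_diag_diag // mulrBl mulr_natl. Qed.

Lemma normal_nseq k m :
  normal (nseq m (k, k)) = \prod_(0 <= r < m) (E (k, k) - r%:R).
Proof.
elim: m => [|m IHm]; first by rewrite big_nil.
rewrite big_nat_recr //= -IHm normal_diag_cons ?count_nseq /=; last first.
  by rewrite /diagonal all_nseq eqxx orbT.
rewrite eqxx mul1n mulrBl mulrBr mulr_natl mulr_natr; congr (_ - _).
(* What remains is that [E (k, k)] commutes with a product of shifted copies of itself: the new
   factor appears on the left in [normal], but on the right in the product. *)
elim: m {IHm} => [|m IHm]; first by rewrite mulr1 mul1r.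
rewrite /= normal_diag_cons; last by rewrite /diagonal all_nseq eqxx orbT.
by rewrite -mulrA -IHm !mulrA mulrBr mulrBl mulr_natl mulr_natr.
Qed.

Lemma normal_diag_eq0 s t : diagonal (s ++ t) -> normal t = 0 -> normal (s ++ t) = 0.
Proof.
move=> + t0; elim: s => [|[i j] s IHs] //= /andP[/eqP/= <- d_st].
by rewrite normal_diag_cons // IHs // mulr0.
Qed.

(** Move [d + 1] copies of [(k, k)] to the end, where they form the product in (R7). The remaining
    diagonal entries only contribute factors on the left. *)
Lemma normal_count k s : diagonal s -> (d < count_mem (k, k) s)%N -> normal s = 0.
Proof.
move=> diag_s lt_d; set c := count_mem _ s in lt_d.
have s_perm : perm_eq s
    ([seq y <- s | y != (k, k)] ++ nseq (c - d.+1) (k, k) ++ nseq d.+1 (k, k)).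
  rewrite -nseqD subnK // perm_sym.
  have -> : nseq c (k, k) = [seq y <- s | y == (k, k)].
    rewrite -[RHS]/(filter (pred1 (k, k)) s).
    by rewrite (all_pred1P _ _ (filter_all _ _)) size_filter.
  by rewrite perm_catC perm_filterC.
rewrite (perm_normal glE s_perm) catA; apply: normal_diag_eq0.
  by rewrite -catA /diagonal -(perm_all _ s_perm).
by rewrite normal_nseq polyE.
Qed.

Lemma size_diagonal s : diagonal s -> size s = (\sum_k count_mem (k, k) s)%N.
Proof.
elim: s => [|[i j] s IHs] /=; first by rewrite big1.
case/andP=> /eqP/= <- /IHs->; rewrite big_split /= -add1n; congr (_ + _)%N.
rewrite (bigD1 i) //= eqxx big1 // => k ne_k.
by rewrite xpair_eqE eq_sym (negPf ne_k).
Qed.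

(* Since [\sum_k normal ((k, k) :: s) = (d - size s) * normal s], vanishing
   propagates down from sequences so long that some entry occurs more than [d]
   times. *)
Lemma normal_diagonal_eq0 s : diagonal s -> (d < size s)%N -> normal s = 0.
Proof.
have [m] := ubnP ((n * d).+1 - size s); elim: m s => // m IHm s.
rewrite ltnS => le_m diag_s lt_s.
have [le_nd|lt_nd] := leqP (size s) (n * d).
  have := sum_normal_diag s; rewrite big1 => [|k _]; last first.
    by apply: IHm; rewrite /= ?eqxx //; lia.
  rewrite add0r => /eqP; rewrite -subr_eq0 -mulrnBr ?(ltnW lt_s) // => /eqP.
  by rewrite -(subnSK lt_s); apply: torsion_free.
have [k lt_k|le_k] := pickP (fun k => d < count_mem (k, k) s)%N.
  exact: normal_count lt_k.
move: lt_nd; rewrite size_diagonal // ltnNge.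
have -> : (n * d = \sum_(k < n) d)%N by rewrite sum_nat_const card_ord.
by rewrite leq_sum // => k _; rewrite leqNgt le_k.
Qed.

Definition off_diagonal s := count (fun y => y.1 != y.2) s.

(** Induction on the number of off-diagonal entries. For [(i, j) :: r], the product of [(j, j) :: r]
    already vanishes, hence so does its commutator with [E (i, j)]. That commutator is a positive
    multiple of the product sought, plus terms killed by the outer induction or by an inner one on
    the number of [(i, i)] in [r]. *)
Lemma normal_eq0 s : (d < size s)%N -> normal s = 0.
Proof.
have [k] := ubnP (off_diagonal s); elim: k s => // k IHk s.
rewrite ltnS => le_k lt_d.
have [diag_s|] := boolP (diagonal s); first exact: normal_diagonal_eq0.
case/allPn=> -[i j] xs /= ne_ij; move: lt_d le_k.
have s_perm := perm_to_rem xs; rewrite (perm_normal glE s_perm).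
rewrite (perm_size s_perm) /off_diagonal (seq.permP s_perm) /= ne_ij add1n.
move: (rem _ s) => r {s xs s_perm}.
have [b] := ubnP (count_mem (i, i) r); elim: b r => // b IHb r.
rewrite ltnS => le_b lt_d lt_k; set x := (i, j); set q := (j, j) :: r.
have q0 : normal q = 0 by apply: IHk; rewrite /off_diagonal /= ?eqxx.
have off_rem y z : y \in q -> y.1 != y.2 -> normal (z :: rem y q) = 0.
  move=> yq ne_y; have q_perm := perm_to_rem yq; apply: IHk.
    have := seq.permP q_perm (fun y => y.1 != y.2).
    by rewrite /off_diagonal /= ne_y eqxx /= add0n add1n; case: (_ != _); lia.
  by have := perm_size q_perm; rewrite /= => <-.
(* Each [(j, j)] becomes [(i, j)]. Any other affected entry is off-diagonal, and removing it lets
   the outer induction apply. *)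
have left_sum : replace_sum (unit_mul x) normal q = normal (x :: r) *+ count_mem (j, j) q.
  rewrite (replace_sum_normal glE).
  rewrite (eq_big_seq (fun y => if y == (j, j) then normal (x :: r) else 0)).
    by rewrite -big_mkcond big_const_seq iter_addr_0.
  move=> [k1 k2] yq; rewrite /unit_mul /= [(k1, k2) == _]xpair_eqE.
  have [eq_k1|_] := eqVneq k1 j; last by [].
  subst k1; rewrite /=; have [eq_k2|ne_k2] := eqVneq k2 j.
    by subst k2; rewrite eqxx.
  by apply: off_rem; rewrite //= eq_sym.
(* Only an entry [(i, i)] turned into [(i, j)] escapes the outer induction; the new sequence has one
   [(i, i)] less, as the inner induction requires. *)
have right_sum : replace_sum (fun y => unit_mul y x) normal q = 0.
  rewrite (replace_sum_normal glE) big_seq big1 // => -[k1 k2] yq.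
  rewrite /unit_mul /=; have [eq_k2|//] := eqVneq k2 i; subst k2.
  have [eq_k1|ne_k1] := eqVneq k1 i; last exact: off_rem.
  subst k1; have ri : (i, i) \in r.
    by move: yq; rewrite inE xpair_eqE andbb (negPf ne_ij).
  rewrite /q /= xpair_eqE andbb [j == i]eq_sym (negPf ne_ij).
  have r_perm := perm_to_rem ri; apply: IHb.
  - have := seq.permP r_perm (pred1 (i, i)).
    by rewrite /= [(j, j) == _]xpair_eqE andbb [j == i]eq_sym (negPf ne_ij) eqxx => eq_b;
      move: le_b; rewrite eq_b.
  - by have := perm_size r_perm; rewrite /= => <-.
  - have := seq.permP r_perm (fun y => y.1 != y.2); rewrite /= !eqxx /=.
    by move=> <-.
have := normal_ad glE x q; rewrite q0 mulr0 mul0r subrr left_sum right_sum subr0.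
by rewrite /= eqxx add1n => /esym/torsion_free.
Qed.

End Vanishing.

(** * The action on tensor space *)

Lemma raddf_replace_sum (T : eqType) (Z Z' : zmodType) (f : Z -> Z')
    (g : T -> option T) (F : seq T -> Z) s :
    f 0 = 0 -> {morph f : a b / a + b} ->
  f (replace_sum g F s) = replace_sum g (fun u => f (F u)) s.
Proof.
move=> f0 fD; elim: s F => //= y s IHs F; rewrite fD IHs.
by case: (g y) => [z|] /=; rewrite ?f0.
Qed.

Section PlaceOperators.
Variables n d : nat.
Local Notation MI := (multi_index n d).
Local Notation V := (tensor_power n d).
Implicit Types (I J : MI) (t : V) (x y : 'I_n * 'I_n) (s : seq ('I_n * 'I_n)).

Definition upd I (a : 'I_d) (j : 'I_n) : MI :=
  [ffun b => if b == a then j else I b].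

Lemma updE I a j b : upd I a j b = if b == a then j else I b.
Proof. by rewrite ffunE. Qed.

Lemma upd_upd I a j k : upd (upd I a j) a k = upd I a k.
Proof. by apply/ffunP=> b; rewrite !updE; case: eqP. Qed.

Lemma updC I a b j k : a != b -> upd (upd I a j) b k = upd (upd I b k) a j.
Proof.
move=> ab; apply/ffunP=> c; rewrite !updE.
by case: eqP => // ->; rewrite eq_sym (negPf ab).
Qed.

(* The derivation action on [V^{(x) d}] of the matrix unit indexed by [x]. *)
Definition unit_act_fun x t : V :=
  [ffun I : MI => \sum_(a | I a == x.1) t (upd I a x.2)].

Fact unit_act_linear x : linear (unit_act_fun x).
Proof.
move=> c t u; apply/ffunP=> I; rewrite !ffunE scaler_sumr -big_split /=.
by apply: eq_bigr => a _; rewrite !ffunE.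
Qed.

HB.instance Definition _ x := GRing.isLinear.Build rat V V
  *:%R (unit_act_fun x) (unit_act_linear x).

Fact unit_act_equivariant x : linfun (unit_act_fun x) \in @equivariant n d.
Proof.
apply/equivariantP=> s t; rewrite !lfunE /=; apply/ffunP=> I; rewrite !ffunE.
rewrite [RHS](reindex_inj (@perm_inj _ s)) /=.
apply: eq_big => [a|a _]; rewrite !ffunE ?permK //; congr (t _).
apply/ffunP=> b; rewrite !ffunE; congr (if _ then _ else _).
by rewrite (can2_eq (permKV s) (permK s)).
Qed.

Definition unit_act x : schur_algebra n d := SchurAlgebra (unit_act_equivariant x).

Lemma schur_ext (f g : schur_algebra n d) :
  (forall t I, f t I = g t I) -> f = g.
Proof.
by move=> fg; apply: val_inj; apply/lfunP=> t; apply/ffunP=> I; apply: fg.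
Qed.

Lemma schur_mulE (f g : schur_algebra n d) t : (f * g) t = f (g t).
Proof. by rewrite /= comp_lfunE. Qed.

Lemma schur_oneE t : (1 : schur_algebra n d) t = t.
Proof. by rewrite /= id_lfunE. Qed.

Lemma schur_zeroE t I : (0 : schur_algebra n d) t I = 0.
Proof. by rewrite zero_lfunE ffunE. Qed.

Lemma schur_addE (f g : schur_algebra n d) t I : (f + g) t I = f t I + g t I.
Proof. by rewrite add_lfunE ffunE. Qed.

Lemma schur_oppE (f : schur_algebra n d) t I : (- f) t I = - f t I.
Proof. by rewrite opp_lfunE ffunE. Qed.

Lemma schur_scaleE c (f : schur_algebra n d) t I : (c *: f) t I = c * f t I.
Proof. by rewrite scale_lfunE ffunE. Qed.

Lemma unit_actE x t I : unit_act x t I = \sum_(a | I a == x.1) t (upd I a x.2).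
Proof. by rewrite lfunE /= ffunE. Qed.

(** When both units act at the same place they multiply as matrices. The terms at two distinct
    places do not depend on the order of [x] and [y], so they cancel in the commutator. *)
Lemma unit_act_mulE x y t I : (unit_act x * unit_act y) t I =
  oapp (fun z => unit_act z t I) 0 (unit_mul x y) +
  \sum_a \sum_(b | [&& a != b, I a == x.1 & I b == y.1])
     t (upd (upd I a x.2) b y.2).
Proof.
rewrite schur_mulE unit_actE.
have -> : oapp (fun z => unit_act z t I) 0 (unit_mul x y) =
          \sum_(a | I a == x.1) if x.2 == y.1 then t (upd I a y.2) else 0.
  by rewrite /unit_mul; case: eqP => _ /=; rewrite ?unit_actE // big1.
rewrite big_mkcond [X in _ = X + _]big_mkcond -big_split /=.
apply: eq_bigr => a _; case: eqP => [Ia|_]; last first.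
  by rewrite big_pred0 ?addr0 // => b; rewrite andbF.
rewrite unit_actE big_mkcond (bigD1 a) //= updE eqxx upd_upd; congr (_ + _).
rewrite -big_mkcondr /=; apply: eq_bigl => b; rewrite updE eq_sym.
by case: eqP.
Qed.

Lemma unit_act_comm x y : unit_act x * unit_act y - unit_act y * unit_act x =
  oapp unit_act 0 (unit_mul x y) - oapp unit_act 0 (unit_mul y x).
Proof.
apply: schur_ext => t I.
rewrite !(schur_addE, schur_oppE) !unit_act_mulE.
have oappE o : oapp (fun z => unit_act z t I) 0 o = oapp unit_act 0 o t I.
  by case: o => //=; rewrite schur_zeroE.
rewrite !oappE; set r1 := \sum_a _; set r2 := \sum_a _.
suff -> : r1 = r2 by rewrite opprD addrACA subrr addr0.
rewrite /r1 (exchange_big_dep xpredT) //=; apply: eq_bigr => b _.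
apply: eq_big => [a|a /and3P[ab _ _]]; last by rewrite updC.
by rewrite eq_sym [(I a == _) && _]andbC.
Qed.

(* The sum over injective assignments of places outside [B] to the entries of
   [s]; the matrix units of [s] then act simultaneously at distinct places. *)
Fixpoint place_normal (B : {set 'I_d}) s t I : rat :=
  if s is x :: s' then
    \sum_(a | (a \notin B) && (I a == x.1)) place_normal (a |: B) s' t (upd I a x.2)
  else t I.

(** The two places are distinct, so updating one of them does not affect the condition at the
    other. *)
Lemma exchange_places (B : {set 'I_d}) I i j k l (F : 'I_d -> 'I_d -> rat) :
  \sum_(a | (a \notin B) && (I a == i))
     \sum_(b | (b \notin a |: B) && (upd I a j b == k)) F a b =
  \sum_(b | (b \notin B) && (I b == k))
     \sum_(a | (a \notin b |: B) && (upd I b l a == i)) F a b.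
Proof.
rewrite (exchange_big_dep (fun b => (b \notin B) && (I b == k))) /=; last first.
  move=> a b _; rewrite !inE negb_or updE => /andP[/andP[ne_ba ->]].
  by rewrite (negPf ne_ba).
apply: eq_bigr => b /andP[bB Ib]; apply: eq_bigl => a.
rewrite !inE !negb_or !updE bB [b == a]eq_sym.
by case: (eqVneq a b) => [->|_] /=; rewrite ?andbF // Ib !andbT.
Qed.

(** The counterpart of [mul_normal]: the unit [x] acts either at a place that [s] leaves free, or at
    the place of an entry [y] of [s], where it multiplies [y]. *)
Lemma place_normal_mul (B : {set 'I_d}) x s t I :
  \sum_(a | (a \notin B) && (I a == x.1)) place_normal B s t (upd I a x.2) =
  place_normal B (x :: s) t I +
  replace_sum (unit_mul x) (fun u => place_normal B u t I) s.
Proof.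
elim: s B I => [|y s IHs] B I /=; first by rewrite addr0.
rewrite replace_sum_sum.
(* The induction hypothesis for [b |: B], solved for its replacement sum. *)
rewrite [X in _ = _ + (_ + X)](eq_bigr (fun b =>
  \sum_(a | (a \notin b |: B) && (upd I b y.2 a == x.1))
     place_normal (b |: B) s t (upd (upd I b y.2) a x.2) -
  place_normal (b |: B) (x :: s) t (upd I b y.2))); last first.
  by move=> b _; rewrite IHs addrAC subrr add0r.
rewrite big_split /= sumrN.
rewrite (exchange_places B I x.1 x.2 y.1 y.2 (fun a b =>
  place_normal (b |: (a |: B)) s t (upd (upd I a x.2) b y.2))) /=.
rewrite [X in X + _](eq_bigr (fun b =>
   \sum_(a | (a \notin b |: B) && (upd I b y.2 a == x.1))
     place_normal (a |: (b |: B)) s t (upd (upd I b y.2) a x.2))); last first.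
  move=> b _; apply: eq_bigr => a /andP[]; rewrite !inE negb_or => /andP[ab _] _.
  by rewrite updC // setUCA.
rewrite addrCA [X in _ = _ + X]addrC subrK.
rewrite -(exchange_places B I x.1 x.2 y.1 y.2 (fun a b =>
  place_normal (b |: B) s t (upd (upd I b y.2) a x.2))).
have -> : oapp (fun z => \sum_(a | (a \notin B) && (I a == z.1))
               place_normal (a |: B) s t (upd I a z.2)) 0 (unit_mul x y) =
    \sum_(a | (a \notin B) && (I a == x.1))
       if x.2 == y.1 then place_normal (a |: B) s t (upd I a y.2) else 0.
  by rewrite /unit_mul; case: eqP => _ //=; rewrite big1.
rewrite -big_split; apply: eq_bigr => a /andP[aB _].
rewrite big_mkcond (bigD1 a) //= aB updE eqxx upd_upd; congr (_ + _).
rewrite -big_mkcondr /=; apply: eq_big => [b|b /andP[ne_ba _]].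
  by rewrite !inE negb_or andbA.
by rewrite updC // eq_sym.
Qed.

Lemma normal_unit_act s t I :
  normal unit_act s t I = place_normal set0 s t I.
Proof.
have [m] := ubnP (size s); elim: m s I => // m IHm [|x s] I.
  by rewrite schur_oneE.
rewrite ltnS => lt_s; rewrite normal_cons schur_addE schur_oppE.
rewrite (raddf_replace_sum (f := fun f : schur_algebra n d => f t I))
  ?schur_zeroE //; last first.
  by move=> f g; apply: schur_addE.
rewrite (eq_replace_sum (h := unit_mul x) (G := fun u => place_normal set0 u t I))
  => // [|u size_u]; last by apply: IHm; rewrite size_u.
apply/(canLR (addrK _)); rewrite -place_normal_mul.
rewrite schur_mulE unit_actE; apply: eq_big => [a|a _]; first by rewrite inE.
exact: IHm.
Qed.

End PlaceOperators.

(** * Closed form of the action of products of length [d] *)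

Section ClosedForm.
Variables n d : nat.
Local Notation MI := (multi_index n d).
Local Notation V := (tensor_power n d).
Implicit Types (I J : MI) (t : V) (s : seq ('I_n * 'I_n)) (w : seq 'I_d).

Fixpoint arrangements (B : {set 'I_d}) m : seq (seq 'I_d) :=
  if m is m'.+1 then
    [seq a :: w | a <- [seq a <- enum 'I_d | a \notin B], w <- arrangements (a |: B) m']
  else [:: [::]].

Lemma mem_arrangements (B : {set 'I_d}) m w :
  (w \in arrangements B m) =
  [&& size w == m, uniq w & all (fun a => a \notin B) w].
Proof.
elim: m B w => [|m IHm] B [|a w]; rewrite /= ?inE //.
- by apply/negbTE/allpairsPdep => -[b [v []]].
- apply/allpairsPdep/idP => [[b [v [/[!mem_filter] /andP[bB _]]]]|].
    rewrite IHm => /and3P[size_v uv av] [-> ->].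
    rewrite eqSS size_v uv bB /= andbT; apply/andP; split.
      by apply/negP=> /(allP av); rewrite !inE eqxx.
    by apply/allP=> c /(allP av); rewrite !inE negb_or => /andP[].
  case/and3P=> size_w /andP[aw uw] /andP[aB allw].
  exists a, w; split=> //; first by rewrite mem_filter aB mem_enum.
  rewrite IHm -eqSS size_w uw; apply/allP=> c cw.
  rewrite !inE negb_or (allP allw) // andbT.
  by apply: contraNneq aw => <-.
Qed.

Lemma arrangements_uniq (B : {set 'I_d}) m : uniq (arrangements B m).
Proof.
elim: m B => //= m IHm B; apply: allpairs_uniq_dep => // [|[a v] [b w] _ _ [-> ->]] //.
by rewrite filter_uniq ?enum_uniq.
Qed.

(** A duplicate-free list of [d] places out of [d] is the list of values of a permutation. *)
Lemma big_arrangements (G : seq 'I_d -> rat) :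
  \sum_(w <- arrangements set0 d) G w =
  \sum_(s : 'S_d) G [seq s p | p <- enum 'I_d].
Proof.
rewrite -(big_map (fun s : 'S_d => [seq s p | p <- enum 'I_d]) xpredT G).
apply: perm_big; apply: uniq_perm; first exact: arrangements_uniq.
  rewrite map_inj_uniq ?index_enum_uniq // => s1 s2 /eq_in_map eq_s.
  by apply/permP=> p; apply: eq_s; rewrite mem_enum.
move=> w; rewrite mem_arrangements; apply/and3P/mapP => [[size_w uw _]|[s _ ->]].
  have inj_w : injective (fun p : 'I_d => tnth (Tuple size_w) p).
    by apply/tuple_uniqP.
  exists (perm inj_w); first exact: mem_index_enum.
  by rewrite (eq_map (permE _)) (map_tnth_enum (Tuple size_w)).
split; first by rewrite size_map size_enum_ord.
  by rewrite map_inj_uniq ?enum_uniq //; apply: perm_inj.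
by apply/allP=> a _; rewrite inE.
Qed.

Fixpoint place_term w s t I : rat :=
  match w, s with
  | a :: w', x :: s' => if I a == x.1 then place_term w' s' t (upd I a x.2) else 0
  | _, _ => t I
  end.

Lemma place_normal_arrangements (B : {set 'I_d}) s t I :
  place_normal B s t I = \sum_(w <- arrangements B (size s)) place_term w s t I.
Proof.
elim: s B I => [|x s IHs] B I /=; first by rewrite big_seq1.
rewrite big_allpairs_dep /= big_filter big_enum_cond /= big_mkcondr /=.
apply: eq_bigr => a aB; case: eqP => // _; last by rewrite big1.
Qed.

(** Up to simultaneous permutation of the places, the pairs [(I, J)] index the usual basis of the
    Schur algebra. *)
Definition graph I J : seq ('I_n * 'I_n) := [seq (I p, J p) | p <- enum 'I_d].

Lemma size_graph I J : size (graph I J) = d.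
Proof. by rewrite size_map size_enum_ord. Qed.

(** For the induction, [enum 'I_d] is generalised to a duplicate-free list [ps]; the places outside
    the image of [ps] keep their value in [I]. *)
Lemma place_term_perm (s : 'S_d) I0 J0 t I ps : uniq ps ->
  place_term [seq s p | p <- ps] [seq (I0 p, J0 p) | p <- ps] t I =
  if all (fun p => I (s p) == I0 p) ps
  then t [ffun a => if s^-1%g a \in ps then J0 (s^-1%g a) else I a] else 0.
Proof.
elim: ps I => [|p ps IHps] I /= => [_|/andP[p_ps /IHps->]].
  by congr (t _); apply/ffunP=> a; rewrite ffunE.
case: eqP => //= _.
have -> : all (fun q => upd I (s p) (J0 p) (s q) == I0 q) ps =
          all (fun q => I (s q) == I0 q) ps.
  apply: eq_in_all => q q_ps; rewrite updE (inj_eq perm_inj).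
  by case: (q =P p) => // eq_qp; rewrite -eq_qp q_ps in p_ps.
case: all => //; congr (t _); apply/ffunP=> a; rewrite !ffunE inE.
rewrite (can2_eq (permKV s) (permK s)); case: (a =P s p) => [->|_] //=.
by rewrite permK (negPf p_ps).
Qed.

(** With [d] entries every place is used, so [I] enters only through the condition on [s]. *)
Lemma normal_graph I0 J0 t I :
  normal (@unit_act n d) (graph I0 J0) t I =
  \sum_(s : 'S_d | [forall p, I (s p) == I0 p]) t [ffun a => J0 (s^-1%g a)].
Proof.
rewrite normal_unit_act place_normal_arrangements size_graph big_arrangements.
rewrite [RHS]big_mkcond; apply: eq_bigr => s _.
rewrite place_term_perm ?enum_uniq //; congr (if _ then t _ else _).
  by apply/allP/forallP=> [Is p|Is p _]; apply: Is; rewrite ?mem_enum.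
by apply/ffunP=> a; rewrite !ffunE mem_enum.
Qed.

Lemma graph_surj s : size s = d -> exists I J, s = graph I J.
Proof.
move/eqP=> size_s; pose w := Tuple size_s.
exists [ffun p => (tnth w p).1], [ffun p => (tnth w p).2].
rewrite -[LHS](map_tnth_enum w); apply: eq_map => p.
by rewrite !ffunE -surjective_pairing.
Qed.

Lemma perm_graph (s : 'S_d) I J :
  perm_eq (graph [ffun p => I (s p)] [ffun p => J (s p)]) (graph I J).
Proof.
have -> : graph [ffun p => I (s p)] [ffun p => J (s p)] =
          [seq (I p, J p) | p <- [seq s p | p <- enum 'I_d]].
  by rewrite -map_comp; apply: eq_map => p /=; rewrite !ffunE.
apply: perm_map; apply: uniq_perm; rewrite ?enum_uniq //.
  by rewrite map_inj_uniq ?enum_uniq //; apply: perm_inj.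
move=> p; rewrite mem_enum; apply/mapP; exists (s^-1%g p); rewrite ?mem_enum //.
by rewrite permKV.
Qed.

End ClosedForm.

(** * The presented algebra *)

Definition commutator (B : pzRingType) (x y : B) := x * y - y * x.

Lemma commutator_lie (B : pzRingType) : lie_bracket (@commutator B).
Proof.
rewrite /commutator; split=> [x y z|x y|x y z].
- by rewrite mulrDl mulrDr opprD addrACA.
- by rewrite opprB.
rewrite !mulrBl !mulrBr !opprB !mulrA.
rewrite [RHS](AC (2*2*(2*2)) ((1*6)*(3*8)*((5*4)*(7*2)))).
by rewrite /= !subrr !add0r.
Qed.

(** Brings the cubic relations of (R4) and (R5) into the form [(ad x)^2 y = 0] used in [ch_eee] and
    [ch_fff]. *)
Lemma commutator_serre (B : pzRingType) (x y : B) :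
  x ^+ 2 * y - (x * y * x) *+ 2 + y * x ^+ 2 = commutator x (commutator x y).
Proof.
rewrite /commutator !mulrBl !mulrBr !expr2 !mulrA opprB mulr2n opprD.
by rewrite !addrA [RHS](ACl (1*2*4*3)).
Qed.

Lemma commutator_morph (A B : pzRingType) (f : A -> B) x y :
    {morph f : a b / a - b} -> {morph f : a b / a * b} ->
  f (x * y - y * x) = commutator (f x) (f y).
Proof. by move=> fB fM; rewrite fB !fM. Qed.

Lemma serre_morph (K : nzRingType) (A : lalgType K) (B : pzRingType) (f : A -> B) x y :
    {morph f : a b / a + b} -> {morph f : a b / a - b} -> {morph f : a b / a * b} ->
  f (x ^+ 2 * y - 2%:R *: (x * y * x) + y * x ^+ 2) =
  commutator (f x) (commutator (f x) (f y)).
Proof.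
move=> fD fB fM; rewrite -commutator_serre scaler_nat !expr2 mulr2n.
by rewrite fD fB fD !fM -mulr2n.
Qed.

(** * Evaluation of the free algebra in the Schur algebra *)

Section Evaluation.
Variables n d : nat.
Local Notation F := (free_algebra rat (gens n)).
Local Notation S := (schur_algebra n d).

Definition gen_act (g : gens n) : S :=
  match g with
  | inl (inl i) => unit_act d (ord_lo i, ord_hi i)
  | inl (inr i) => unit_act d (ord_hi i, ord_lo i)
  | inr i => unit_act d (i, i)
  end.

Definition monom_act (m : {fmonom gens n}) : S :=
  \prod_(i <- (m : seq (gens n))) gen_act i.

Definition schur_eval (x : F) : S :=
  \sum_(m <- msupp x) x@_m *: monom_act m.

Lemma schur_evalEw (D : {fset {fmonom gens n}}) x : (msupp x `<=` D)%fset ->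
  schur_eval x = \sum_(m <- D) x@_m *: monom_act m.
Proof.
move=> le; rewrite [LHS](big_fset_incl _ le) => //= m mD /mcoeff_outdom ->.
by rewrite scale0r.
Qed.

Fact schur_eval_linear : linear schur_eval.
Proof.
move=> c x y; have le_xy : (msupp (c *: x + y) `<=` msupp x `|` msupp y)%fset.
  by apply: fsubset_trans (msuppD_le _ _) (fsetUSS (msuppZ_le _ _) (fsubset_refl _)).
rewrite (schur_evalEw le_xy) (schur_evalEw (fsubsetUl (msupp x) (msupp y))).
rewrite (schur_evalEw (fsubsetUr (msupp x) (msupp y))) scaler_sumr -big_split /=.
by apply: eq_bigr => m _; rewrite mcoeffD mcoeffZ scalerDl scalerA.
Qed.

HB.instance Definition _ := GRing.isLinear.Build rat F S *:%R schur_eval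
  schur_eval_linear.

Lemma schur_evalU c m : schur_eval << c *g m >> = c *: monom_act m.
Proof. by rewrite (schur_evalEw msuppU_le) big_seq_fset1 mcoeffUU. Qed.

Fact schur_eval_monoid_morphism : monoid_morphism schur_eval.
Proof.
split=> [|x y].
  by rewrite -mpolyC1E schur_evalU scale1r /monom_act fm1 big_nil.
rewrite malgME raddf_sum mulr_suml /=; apply: eq_bigr=> k _.
rewrite raddf_sum mulr_sumr /=; apply: eq_bigr=> l _.
rewrite schur_evalU /monom_act fmM big_cat /=.
by rewrite -schur_scalerAl -schur_scalerAr scalerA.
Qed.

Lemma schur_evalM x y : schur_eval (x * y) = schur_eval x * schur_eval y.
Proof. by case: schur_eval_monoid_morphism. Qed.

Lemma schur_evalB x y : schur_eval (x - y) = schur_eval x - schur_eval y.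
Proof. exact: raddfB. Qed.

Lemma schur_evalD x y : schur_eval (x + y) = schur_eval x + schur_eval y.
Proof. exact: raddfD. Qed.

Lemma schur_evalZ c x : schur_eval (c *: x) = c *: schur_eval x.
Proof. exact: linearZ. Qed.

Lemma schur_eval_nat m : schur_eval m%:R = m%:R.
Proof. by rewrite raddfMn /=; case: schur_eval_monoid_morphism => ->. Qed.

Lemma schur_eval_commutator x y :
  schur_eval (x * y - y * x) = commutator (schur_eval x) (schur_eval y).
Proof. exact: commutator_morph schur_evalB schur_evalM. Qed.

Lemma schur_eval_serre x y :
  schur_eval (x ^+ 2 * y - 2%:R *: (x * y * x) + y * x ^+ 2) =
  commutator (schur_eval x) (commutator (schur_eval x) (schur_eval y)).
Proof. exact: serre_morph schur_evalD schur_evalB schur_evalM. Qed.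

Lemma schur_eval_gen g : schur_eval (free_gen rat g) = gen_act g.
Proof. by rewrite schur_evalU scale1r /monom_act fmU big_seq1. Qed.

End Evaluation.

Lemma pairing_eps_alpha n (i : 'I_n) (j : 'I_n.-1) :
  pairing (eps i) (alpha j) = (i == ord_lo j)%:R - (i == ord_hi j)%:R.
Proof.
rewrite /pairing (bigD1 i) //= !mxE !eqxx mul1r big1 ?addr0 //.
by move=> k ne_k; rewrite !mxE eqxx (negPf ne_k) mul0r.
Qed.

(** * The defining relations hold in the Schur algebra *)

Section SchurRelations.
Variables n d : nat.
Local Notation S := (schur_algebra n d).

Lemma commutator_unit_act (i j k l : 'I_n) :
  commutator (unit_act d (i, j)) (unit_act d (k, l)) =
  unit_act d (i, l) *+ (j == k) - unit_act d (k, j) *+ (l == i).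
Proof. by rewrite /commutator unit_act_comm /unit_mul /=; do 2!case: ifP. Qed.

(** For [i != j] the square of [ad E_ij] kills every matrix unit except [E_ji], which the second
    hypothesis excludes. *)
Lemma serre_unit_act (i j k l : 'I_n) : i != j -> (j != k) || (l != i) ->
  commutator (unit_act d (i, j)) (commutator (unit_act d (i, j)) (unit_act d (k, l))) = 0.
Proof.
have lie := commutator_lie (schur_algebra n d); move=> ne_ij ne_jkl.
have ne_ji : (j == i) = false by rewrite eq_sym (negPf ne_ij).
rewrite commutator_unit_act (brBr lie).
have -> : commutator (unit_act d (i, j)) (unit_act d (i, l) *+ (j == k)) = 0.
  have [eq_jk|_] := eqVneq j k; last by rewrite (br0r lie).
  rewrite mulr1n commutator_unit_act ne_ji.
  by rewrite eq_jk eqxx in ne_jkl; rewrite (negPf ne_jkl) subrr.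
have -> : commutator (unit_act d (i, j)) (unit_act d (k, j) *+ (l == i)) = 0.
  have [eq_li|_] := eqVneq l i; last by rewrite (br0r lie).
  rewrite mulr1n commutator_unit_act ne_ji.
  by rewrite eq_li eqxx orbF in ne_jkl; rewrite (negPf ne_jkl) subrr.
exact: subrr.
Qed.

Lemma unit_act_diagE (k : 'I_n) (t : tensor_power n d) (I : multi_index n d) :
  unit_act d (k, k) t I = (\sum_(a | I a == k) 1) * t I.
Proof.
rewrite unit_actE mulr_suml; apply: eq_bigr => a /= /eqP Ia; rewrite mul1r.
by congr (t _); apply/ffunP=> b; rewrite updE -Ia; case: eqP => // ->.
Qed.

Lemma schur_natE m (t : tensor_power n d) (I : multi_index n d) :
  (m%:R : S) t I = m%:R * t I.
Proof.
elim: m => [|m IHm]; first by rewrite schur_zeroE mul0r.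
by rewrite mulrS schur_addE IHm schur_oneE mulrS mulrDl mul1r.
Qed.

Lemma sum_unit_act : \sum_(k < n) unit_act d (k, k) = d%:R.
Proof.
apply: schur_ext => t I.
rewrite schur_natE (big_morph (fun f : S => f t I) (id1 := 0) (op1 := +%R)); first last.
- exact: schur_zeroE.
- by move=> f g; apply: schur_addE.
under eq_bigr do rewrite unit_act_diagE.
rewrite -mulr_suml; congr (_ * _).
rewrite (exchange_big_dep xpredT) //= -[d in RHS]card_ord -sumr_const.
by apply: eq_bigr => a _; rewrite (big_pred1 (I a)) // => k; rewrite eq_sym.
Qed.

(** On the coordinate [I] the operator multiplies by the number [c <= d] of places where [I] takes
    the value [k], so the factor with [m = c] vanishes. *)
Lemma prod_unit_act (k : 'I_n) : \prod_(0 <= m < d.+1) (unit_act d (k, k) - m%:R) = 0.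
Proof.
apply: schur_ext => t I; rewrite schur_zeroE.
set c := #|[pred a | I a == k]|.
have -> : forall r, (\prod_(m <- r) (unit_act d (k, k) - m%:R)) t I =
                    \prod_(m <- r) (c%:R - m%:R) * t I.
  elim=> [|m r IHr]; first by rewrite !big_nil schur_oneE mul1r.
  rewrite !big_cons schur_mulE schur_addE schur_oppE unit_act_diagE sumr_const.
  by rewrite schur_natE IHr -mulrBl mulrA.
rewrite (_ : \prod_(m <- _) _ = 0) ?mul0r //; apply/eqP.
rewrite prodf_seq_eq0; apply/hasP; exists c; last by rewrite /= subrr.
by rewrite mem_index_iota ltnS; have := max_card [pred a | I a == k]; rewrite card_ord.
Qed.

Lemma ord_hi_loE (i j : 'I_n.-1) : (ord_hi i == ord_lo j) = (i.+1 == j).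
Proof. by rewrite -val_eqE. Qed.

Lemma ord_lo_hiE (i j : 'I_n.-1) : (ord_lo i == ord_hi j) = (j.+1 == i).
Proof. by rewrite -val_eqE eq_sym. Qed.

Lemma ord_loE (i j : 'I_n.-1) : (ord_lo i == ord_lo j) = (i == j).
Proof. by rewrite -!val_eqE. Qed.

Lemma ord_hiE (i j : 'I_n.-1) : (ord_hi i == ord_hi j) = (i == j).
Proof. by rewrite -!val_eqE. Qed.

Lemma schur_eval_rel r : @schur_relation n d r -> @schur_eval n d r = 0.
Proof.
case=> [i j|i j|i j|i j|i j|i j|i j|i j||k].
- rewrite schur_eval_commutator !schur_eval_gen commutator_unit_act [j == i]eq_sym.
  by case: eqP => [->|_]; rewrite subrr.
- rewrite schur_evalB schur_eval_commutator schur_evalZ schur_evalB !schur_eval_gen.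
  rewrite commutator_unit_act ord_hiE ord_loE [j == i]eq_sym scaler_nat mulrnBl.
  by case: eqP => [->|_]; rewrite subrr.
- rewrite schur_evalB schur_evalZ schur_eval_commutator !schur_eval_gen.
  rewrite commutator_unit_act pairing_eps_alpha rmorphB /= !rmorph_nat scalerBl.
  rewrite !scaler_nat [ord_hi j == i]eq_sym.
  by apply/eqP; rewrite subr_eq0; apply/eqP; congr (_ - _); case: eqP => // ->.
- rewrite schur_evalB schur_evalZ schur_eval_commutator !schur_eval_gen.
  rewrite commutator_unit_act pairing_eps_alpha rmorphB /= !rmorph_nat opprB scalerBl.
  rewrite !scaler_nat [ord_lo j == i]eq_sym.
  by apply/eqP; rewrite subr_eq0; apply/eqP; congr (_ - _); case: eqP => // ->.
- rewrite /adjacent => adj; rewrite schur_eval_serre !schur_eval_gen.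
  by apply: serre_unit_act; rewrite ?ord_lo_hiE ?ord_hi_loE; lia.
- rewrite /adjacent => adj; rewrite schur_eval_commutator !schur_eval_gen.
  rewrite commutator_unit_act ord_hi_loE [ord_hi j == _]ord_hi_loE.
  have -> : (i.+1 == j) = false by lia.
  by have -> : (j.+1 == i) = false by [lia]; rewrite subrr.
- rewrite /adjacent => adj; rewrite schur_eval_serre !schur_eval_gen.
  by apply: serre_unit_act; rewrite ?ord_lo_hiE ?ord_hi_loE; lia.
- rewrite /adjacent => adj; rewrite schur_eval_commutator !schur_eval_gen.
  rewrite commutator_unit_act ord_lo_hiE [ord_lo j == _]ord_lo_hiE.
  have -> : (i.+1 == j) = false by lia.
  by have -> : (j.+1 == i) = false by [lia]; rewrite subrr.
- rewrite schur_evalB raddf_sum schur_eval_nat.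
  rewrite (eq_bigr (fun i => unit_act d (i, i))) => [|i _]; last exact: schur_eval_gen.
  by rewrite sum_unit_act subrr.
- rewrite -(prod_unit_act k).
  rewrite (big_morph _ (@schur_evalM n d) (id1 := 1) (schur_eval_nat n d 1)).
  by apply: eq_bigr => m _; rewrite schur_evalB schur_eval_gen schur_eval_nat.
Qed.
End SchurRelations.

Lemma lmod_rat_torsion (M : lmodType rat) (x : M) m : x *+ m.+1 = 0 -> x = 0.
Proof.
move/eqP; rewrite -scaler_nat scaler_eq0 => /orP[|/eqP//].
by rewrite Num.Theory.pnatr_eq0.
Qed.

(** * The [gl_n] relations in the presented algebra *)

Section PresentedSchur.
Variables n d : nat.
Local Notation F := (free_algebra rat (gens n)).
Local Notation T := (schur_presented n d).
Local Notation S := (schur_algebra n d).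

Definition presented_class (x : F) : T := presented_proj (@schur_relation n d) x.
Local Notation p := presented_class.

Lemma presented_classD x y : p (x + y) = p x + p y.
Proof. exact: presented_projD. Qed.

Lemma presented_classM x y : p (x * y) = p x * p y.
Proof. by symmetry; apply: presented_mulE. Qed.

Lemma presented_classZ c x : p (c *: x) = c *: p x.
Proof. by symmetry; apply: presented_scaleE. Qed.

Lemma presented_class1 : p 1 = 1.
Proof. by []. Qed.

Lemma presented_class0 : p 0 = 0.
Proof. by apply: (addrI (p 0)); rewrite -presented_classD !addr0. Qed.

Lemma presented_classB x y : p (x - y) = p x - p y.
Proof. by apply: (addIr (p y)); rewrite -presented_classD !subrK. Qed.

Lemma presented_class_sum (J : Type) (r : seq J) (P : pred J) (G : J -> F) :
  p (\sum_(i <- r | P i) G i) = \sum_(i <- r | P i) p (G i).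
Proof. exact: (big_morph _ presented_classD presented_class0). Qed.

Lemma presented_class_prod (J : Type) (r : seq J) (P : pred J) (G : J -> F) :
  p (\prod_(i <- r | P i) G i) = \prod_(i <- r | P i) p (G i).
Proof. exact: (big_morph _ presented_classM presented_class1). Qed.

Lemma presented_class_nat m : p m%:R = m%:R.
Proof.
elim: m => [|m IHm]; first exact: presented_class0.
by rewrite mulrS presented_classD IHm mulrS.
Qed.

Lemma presented_class_rel r : schur_relation d r -> p r = 0.
Proof. exact: presented_rel. Qed.

Lemma presented_class_commutator x y : p (x * y - y * x) = commutator (p x) (p y).
Proof. exact: commutator_morph presented_classB presented_classM. Qed.

Lemma presented_class_serre x y :
  p (x ^+ 2 * y - 2%:R *: (x * y * x) + y * x ^+ 2) =
  commutator (p x) (commutator (p x) (p y)).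
Proof. exact: serre_morph presented_classD presented_classB presented_classM. Qed.

Definition presented_lift (q : T) : F :=
  generic_quotient.repr (q : presented_algebra (@schur_relation n d)).

Lemma presented_liftK q : p (presented_lift q) = q.
Proof. exact: presented_projK. Qed.

Definition ext_ord m (g : 'I_m -> T) (k : nat) : T := oapp g 0 (insub k).

Lemma ext_ordE m (g : 'I_m -> T) (i : 'I_m) : ext_ord g i = g i.
Proof. by rewrite /ext_ord valK. Qed.

Definition chev_e := ext_ord (fun i => p (gen_e i)).
Definition chev_f := ext_ord (fun i => p (gen_f i)).
Definition chev_H := ext_ord (fun i => p (gen_H i)).

Variant ext_ord_spec m (g : 'I_m -> T) (k : nat) : T -> Prop :=
| ExtOrdOut of (m <= k)%N : ext_ord_spec g k 0
| ExtOrdIn (i : 'I_m) of k = i : ext_ord_spec g k (g i).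

Lemma ext_ordP m (g : 'I_m -> T) k : ext_ord_spec g k (ext_ord g k).
Proof.
rewrite /ext_ord; case: insubP => [i _ Di|]; first by constructor.
by rewrite -leqNgt; constructor.
Qed.

Lemma presented_torsion (x : T) m : x *+ m.+1 = 0 -> x = 0.
Proof. exact: lmod_rat_torsion. Qed.

Lemma presented_chevalley : chevalley (@commutator T) n chev_e chev_f chev_H.
Proof.
have lie := commutator_lie T.
have rel := presented_class_rel; have comE := presented_class_commutator.
split=> // [x|i j|i j ij|i lt_i|i j|i j|i j ij ji|i j ij|i j ij ji|i j ij];
  rewrite /chev_e /chev_f /chev_H.
- by move/eqP; rewrite -addr_eq0 -mulr2n => /eqP/presented_torsion.
- case: ext_ordP => [_|{}i _]; first exact: br0l.
  case: ext_ordP => [_|{}j _]; first exact: br0r.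
  by rewrite -comE; apply/rel/rel_HH.
- case: ext_ordP => [_|i' Di]; first exact: br0l.
  case: ext_ordP => [_|j' Dj]; first exact: br0r.
  have := rel _ (rel_ef d i' j').
  rewrite presented_classB comE presented_classZ -val_eqE /= -Di -Dj (negPf ij).
  by rewrite scale0r subr0.
- have lt_i1 : (i < n.-1)%N by lia.
  have := rel _ (rel_ef d (Ordinal lt_i1) (Ordinal lt_i1)).
  rewrite presented_classB comE presented_classZ eqxx scale1r presented_classB.
  move/eqP; rewrite subr_eq0 => /eqP.
  have extE (g : 'I_n.-1 -> T) : ext_ord g i = g (Ordinal lt_i1).
    exact: (ext_ordE g (Ordinal lt_i1)).
  rewrite !extE => ->; congr (_ - _).
    exact: esym (ext_ordE _ (ord_lo (Ordinal lt_i1))).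
  exact: esym (ext_ordE _ (ord_hi (Ordinal lt_i1))).
- case: (ext_ordP _ j) => [_|j' ->{j}].
    by rewrite (br0r lie) !mul0rn subrr.
  (* For [i >= n] both sides are zero: [j' < n - 1] keeps [i] apart from [j'] and [j'.+1]. *)
  case: ext_ordP => [le_i|i' ->{i}].
    rewrite (br0l lie); have := ltn_ord j' => lt_j.
    have -> : (i == j') = false by lia.
    by have -> : (i == j'.+1) = false by [lia]; rewrite subrr.
  have := rel _ (rel_He d i' j').
  rewrite presented_classB comE presented_classZ => /eqP; rewrite subr_eq0 => /eqP->.
  by rewrite pairing_eps_alpha rmorphB /= !rmorph_nat scalerBl !scaler_nat.
- case: (ext_ordP _ j) => [_|j' ->{j}].
    by rewrite (br0r lie) !mul0rn subrr.
  case: ext_ordP => [le_i|i' ->{i}].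
    rewrite (br0l lie); have := ltn_ord j' => lt_j.
    have -> : (i == j') = false by lia.
    by have -> : (i == j'.+1) = false by [lia]; rewrite subrr.
  have := rel _ (rel_Hf d i' j').
  rewrite presented_classB comE presented_classZ => /eqP; rewrite subr_eq0 => /eqP->.
  by rewrite pairing_eps_alpha rmorphB /= !rmorph_nat opprB scalerBl !scaler_nat.
- case: ext_ordP => [_|i' Di]; first exact: br0l.
  case: ext_ordP => [_|j' Dj]; first exact: br0r.
  rewrite -comE; apply/rel/rel_ee_nadj; rewrite /adjacent; lia.
- case: (ext_ordP _ i) => [_|i' Di]; first exact: br0l.
  case: ext_ordP => [_|j' Dj]; first by rewrite !(br0r lie).
  by rewrite -presented_class_serre; apply/rel/rel_ee_adj; rewrite /adjacent -Di -Dj.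
- case: ext_ordP => [_|i' Di]; first exact: br0l.
  case: ext_ordP => [_|j' Dj]; first exact: br0r.
  rewrite -comE; apply/rel/rel_ff_nadj; rewrite /adjacent; lia.
- case: (ext_ordP _ i) => [_|i' Di]; first exact: br0l.
  case: ext_ordP => [_|j' Dj]; first by rewrite !(br0r lie).
  by rewrite -presented_class_serre; apply/rel/rel_ff_adj; rewrite /adjacent -Di -Dj.
Qed.

Definition gl_root (x : 'I_n * 'I_n) : T :=
  root_element (@commutator T) chev_e chev_f chev_H x.1 x.2.

Lemma root_gl x y : gl_root x * gl_root y - gl_root y * gl_root x =
  oapp gl_root 0 (unit_mul x y) - oapp gl_root 0 (unit_mul y x).
Proof.
case: x y => [i j] [k l]; have := chevalley_gl presented_chevalley (ltn_ord k) (ltn_ord l).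
move/(_ i j (ltn_ord i) (ltn_ord j)); rewrite /commutator => ->; rewrite /unit_mul /=.
by rewrite -!val_eqE /=; do 2!case: ifP.
Qed.

Lemma root_diag k : gl_root (k, k) = p (gen_H k).
Proof. by rewrite /gl_root /root_element ltnn /chev_H ext_ordE. Qed.

Lemma root_e (i : 'I_n.-1) : gl_root (ord_lo i, ord_hi i) = p (gen_e i).
Proof. by rewrite /gl_root /root_element /= ltnSn subSnn /= /chev_e ext_ordE. Qed.

Lemma root_f (i : 'I_n.-1) : gl_root (ord_hi i, ord_lo i) = p (gen_f i).
Proof.
by rewrite /gl_root /root_element /= ltnNge leqnSn /= ltnSn subSnn /= /chev_f ext_ordE.
Qed.

Lemma sum_root_diag : \sum_k gl_root (k, k) = d%:R.
Proof.
have := presented_class_rel (@rel_sumH n d).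
rewrite presented_classB presented_class_sum presented_class_nat => /eqP.
rewrite subr_eq0 => /eqP <-; apply: eq_bigr => k _; exact: root_diag.
Qed.

Lemma prod_root_diag k : \prod_(0 <= m < d.+1) (gl_root (k, k) - m%:R) = 0.
Proof.
rewrite -(presented_class_rel (@rel_Hpoly n d k)) presented_class_prod.
apply: eq_bigr => m _.
by rewrite presented_classB presented_class_nat root_diag.
Qed.

End PresentedSchur.

Lemma map_normal n (A B : pzRingType) (f : A -> B) (E : 'I_n * 'I_n -> A)
    (E' : 'I_n * 'I_n -> B) s :
    {morph f : a b / a - b} -> {morph f : a b / a * b} -> f 1 = 1 ->
    (forall x, f (E x) = E' x) ->
  f (normal E s) = normal E' s.
Proof.
move=> fB fM f1 fE.
have f0 : f 0 = 0 by rewrite -(subrr 0) fB subrr.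
have fN a : f (- a) = - f a by rewrite -[- a]sub0r fB f0 sub0r.
have fD : {morph f : a b / a + b} by move=> a b; rewrite -{1}[b]opprK fB fN opprK.
have [m] := ubnP (size s); elim: m s => // m IHm [|x s]; first by rewrite /normal /= f1.
rewrite ltnS => lt_s; rewrite !normal_cons fB fM fE IHm //.
rewrite (raddf_replace_sum _ _ _ f0 fD).
by congr (_ - _); apply: eq_replace_sum => // u size_u; rewrite IHm // size_u.
Qed.

(** * The two mutually inverse maps *)

Section Isomorphism.
Variables n d : nat.
Local Notation F := (free_algebra rat (gens n)).
Local Notation T := (schur_presented n d).
Local Notation S := (schur_algebra n d).
Local Notation MI := (multi_index n d).
Local Notation p := (@presented_class n d).
Local Notation gl_root := (@gl_root n d).

Definition schur_map (q : T) : S := schur_eval d (presented_lift q).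

(** The kernel of [schur_eval] is a two-sided ideal containing the relations, so the chosen
    representative does not matter. *)
Lemma schur_map_class x : schur_map (p x) = schur_eval d x.
Proof.
apply/eqP; rewrite -subr_eq0 /schur_map -schur_evalB; apply/eqP.
have : presented_lift (p x) - x \in relation_ideal (@schur_relation n d).
  by apply/presented_projP; apply: presented_liftK.
move/relation_idealP/(_ (fun y => schur_eval d y = 0)); apply.
  split=> [|y z y0 z0|a y b y0]; first by rewrite -[0]/(0%:R) schur_eval_nat.
    by rewrite schur_evalD y0 z0 addr0.
  by rewrite (schur_evalM d (a * y)) (schur_evalM d a) y0 mulr0 mul0r.
exact: schur_eval_rel.
Qed.

Lemma schur_mapD q r : schur_map (q + r) = schur_map q + schur_map r.
Proof.
rewrite -[q]presented_liftK -[r]presented_liftK -presented_classD.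
by rewrite !schur_map_class schur_evalD.
Qed.

Lemma schur_mapZ c q : schur_map (c *: q) = c *: schur_map q.
Proof.
by rewrite -[q]presented_liftK -presented_classZ !schur_map_class schur_evalZ.
Qed.

Lemma schur_mapM q r : schur_map (q * r) = schur_map q * schur_map r.
Proof.
rewrite -[q]presented_liftK -[r]presented_liftK -presented_classM.
by rewrite !schur_map_class schur_evalM.
Qed.

Lemma schur_map1 : schur_map 1 = 1.
Proof. by rewrite -presented_class1 schur_map_class; apply: (schur_eval_nat n d 1). Qed.

Lemma schur_map0 : schur_map 0 = 0.
Proof. by rewrite -(scale0r 0) schur_mapZ scale0r. Qed.

Lemma schur_mapB q r : schur_map (q - r) = schur_map q - schur_map r.
Proof. by rewrite schur_mapD -scaleN1r schur_mapZ scaleN1r. Qed.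

Lemma schur_map_commutator q r :
  schur_map (commutator q r) = commutator (schur_map q) (schur_map r).
Proof. exact: commutator_morph schur_mapB schur_mapM. Qed.

Lemma schur_map_positive (i j : 'I_n) k : (j = (i + k).+1 :> nat) ->
  schur_map (root_vector (@commutator T) (chev_e n d) i k) = unit_act d (i, j).
Proof.
have simple (m : 'I_n.-1) : schur_map (chev_e n d m) = unit_act d (ord_lo m, ord_hi m).
  by rewrite /chev_e ext_ordE schur_map_class schur_eval_gen.
elim: k j => [|k IHk] j Dj.
  have lt_i : (i < n.-1)%N by have := ltn_ord j; lia.
  rewrite /= -[nat_of_ord i]/(nat_of_ord (Ordinal lt_i)) simple.
  by congr (unit_act d (_, _)); apply: val_inj; rewrite //= Dj addn0.
have lt_k : ((i + k).+1 < n)%N by have := ltn_ord j; lia.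
have lt_k' : ((i + k).+1 < n.-1)%N by have := ltn_ord j; lia.
rewrite [root_vector _ _ _ _]/= schur_map_commutator (IHk (Ordinal lt_k)) //.
rewrite -[(i + k).+1]/(nat_of_ord (Ordinal lt_k')) simple.
have -> : ord_lo (Ordinal lt_k') = Ordinal lt_k by apply: val_inj.
have -> : ord_hi (Ordinal lt_k') = j by apply: val_inj; rewrite /= Dj addnS.
rewrite commutator_unit_act eqxx.
by have -> : (j == i) = false by [rewrite -val_eqE /=; lia]; rewrite subr0.
Qed.

Lemma schur_map_negative (i j : 'I_n) k : (j = (i + k).+1 :> nat) ->
  schur_map (root_vector (fun x y => commutator y x) (chev_f n d) i k) =
  unit_act d (j, i).
Proof.
have simple (m : 'I_n.-1) : schur_map (chev_f n d m) = unit_act d (ord_hi m, ord_lo m).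
  by rewrite /chev_f ext_ordE schur_map_class schur_eval_gen.
elim: k j => [|k IHk] j Dj.
  have lt_i : (i < n.-1)%N by have := ltn_ord j; lia.
  rewrite /= -[nat_of_ord i]/(nat_of_ord (Ordinal lt_i)) simple.
  by congr (unit_act d (_, _)); apply: val_inj; rewrite //= Dj addn0.
have lt_k : ((i + k).+1 < n)%N by have := ltn_ord j; lia.
have lt_k' : ((i + k).+1 < n.-1)%N by have := ltn_ord j; lia.
rewrite [root_vector _ _ _ _]/= schur_map_commutator (IHk (Ordinal lt_k)) //.
rewrite -[(i + k).+1]/(nat_of_ord (Ordinal lt_k')) simple.
have -> : ord_lo (Ordinal lt_k') = Ordinal lt_k by apply: val_inj.
have -> : ord_hi (Ordinal lt_k') = j by apply: val_inj; rewrite /= Dj addnS.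
rewrite commutator_unit_act eqxx [i == j]eq_sym.
by have -> : (j == i) = false by [rewrite -val_eqE /=; lia]; rewrite subr0.
Qed.

Lemma schur_map_root x : schur_map (gl_root x) = unit_act d x.
Proof.
case: x => i j; have [lt_ij|lt_ji|eq_ij] := ltngtP i j.
- by rewrite /gl_root /root_element lt_ij /=; apply: schur_map_positive; lia.
- rewrite /gl_root /root_element ltnNge ltnW //= lt_ji.
  by apply: schur_map_negative; lia.
- have -> : j = i by apply: val_inj.
  by rewrite root_diag schur_map_class schur_eval_gen.
Qed.

Lemma schur_map_normal s : schur_map (normal gl_root s) = normal (@unit_act n d) s.
Proof. exact: map_normal schur_mapB schur_mapM schur_map1 schur_map_root. Qed.

Definition basis_tensor (J : MI) : tensor_power n d := [ffun K => (K == J)%:R].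

Lemma tensor_decomposition (t : tensor_power n d) :
  t = \sum_J t J *: basis_tensor J.
Proof.
apply/ffunP=> I; rewrite sum_ffunE (bigD1 I) //= !ffunE eqxx big1 ?addr0.
  by rewrite /GRing.scale /= mulr1.
by move=> J ne_J; rewrite !ffunE eq_sym (negPf ne_J); apply: scaler0.
Qed.

Lemma schur_decomposition (f : S) t I : f t I = \sum_J f (basis_tensor J) I * t J.
Proof.
rewrite {1}[t]tensor_decomposition linear_sum sum_ffunE; apply: eq_bigr => J _.
by rewrite linearZ ffunE mulrC.
Qed.

Definition place_comp (s : 'S_d) (J : MI) : MI := [ffun k => J (s k)].

Lemma place_compK s : cancel (place_comp s) (place_comp s^-1%g).
Proof. by move=> J; apply/ffunP=> k; rewrite !ffunE permKV. Qed.

(** Equivariance means that matrix coefficients are constant on the orbits of the place permutations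
    on pairs [(I, J)]. *)
Lemma schur_coef_equivariant (f : S) s I J :
  f (basis_tensor (place_comp s J)) (place_comp s I) = f (basis_tensor J) I.
Proof.
have /equivariantP eq_f := schur_valP f.
(* [place_perm] composes with the inverse permutation, hence [s^-1]. *)
have := eq_f (s^-1)%g (basis_tensor (place_comp s J)) => {eq_f}.
have -> : place_perm n (s^-1)%g (basis_tensor (place_comp s J)) = basis_tensor J.
  rewrite lfunE; apply/ffunP=> K; rewrite !ffunE invgK -/(place_comp s K).
  by rewrite (inj_eq (can_inj (place_compK s))).
by move=> ->; rewrite lfunE ffunE invgK.
Qed.

(** By [normal_graph] each product acts as a sum over all permutations, so the double sum reproduces
    an equivariant [f] exactly [d!] times. *)
Definition schur_inv (f : S) : T :=
  (d`!%:R)^-1 *: \sum_I \sum_J f (basis_tensor J) I *: normal gl_root (graph I J).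

Lemma schur_invD f g : schur_inv (f + g) = schur_inv f + schur_inv g.
Proof.
rewrite /schur_inv -scalerDr -big_split; congr (_ *: _); apply: eq_bigr => I _.
by rewrite -big_split; apply: eq_bigr => J _; rewrite schur_addE scalerDl.
Qed.

Lemma schur_invZ c f : schur_inv (c *: f) = c *: schur_inv f.
Proof.
rewrite /schur_inv scalerA mulrC -scalerA; congr (_ *: _).
rewrite scaler_sumr; apply: eq_bigr => I _; rewrite scaler_sumr.
by apply: eq_bigr => J _; rewrite schur_scaleE scalerA.
Qed.

Lemma fact_rat_neq0 : d`!%:R != 0 :> rat.
Proof. by rewrite Num.Theory.pnatr_eq0 -lt0n fact_gt0. Qed.

Lemma schur_sumE (J : finType) (G : J -> S) t I :
  (\sum_i G i) t I = \sum_i G i t I.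
Proof.
apply: (big_morph (fun f : S => f t I)); last exact: schur_zeroE.
by move=> f g; apply: schur_addE.
Qed.

Lemma schur_map_sum (J : finType) (G : J -> T) :
  schur_map (\sum_i G i) = \sum_i schur_map (G i).
Proof. exact: (big_morph _ schur_mapD schur_map0). Qed.

Lemma schur_invK : cancel schur_inv schur_map.
Proof.
move=> f; apply: schur_ext => t I.
rewrite schur_mapZ schur_scaleE schur_map_sum schur_sumE.
apply: (canLR (mulKf fact_rat_neq0)).
(* With the permutations outermost, each [s] selects the single [I0 = place_comp s I] and
   contributes [f t I] by equivariance. *)
transitivity (\sum_(s : 'S_d) \sum_I0 \sum_J0
    (if I0 == place_comp s I
     then f (basis_tensor J0) I0 * t (place_comp s^-1%g J0) else 0)).
  rewrite exchange_big; apply: eq_bigr => I0 _.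
  rewrite schur_map_sum schur_sumE exchange_big; apply: eq_bigr => J0 _.
  rewrite schur_mapZ schur_scaleE schur_map_normal normal_graph mulr_sumr.
  rewrite big_mkcond; apply: eq_bigr => s _ /=; congr (if _ then _ else _).
    apply/forallP/eqP => [I_s|-> k]; last by rewrite ffunE.
    by apply/ffunP=> k; rewrite ffunE; apply/esym/eqP/I_s.
rewrite (eq_bigr (fun=> f t I)) => [|s _].
  by rewrite sumr_const card_Sn mulr_natl.
rewrite (bigD1 (place_comp s I)) //= [X in _ + X]big1 ?addr0 => [|I0 ne_I0]; last first.
  by rewrite big1 // => J0 _; rewrite (negPf ne_I0).
rewrite [RHS]schur_decomposition.
rewrite (reindex_inj (can_inj (place_compK s))); apply: eq_bigr => J _.
by rewrite eqxx schur_coef_equivariant place_compK.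
Qed.

(** Each of the [d!] permutations contributes one rearrangement of [s], whose product is the same by
    [perm_normal]. *)
Lemma schur_inv_normal s : size s = d ->
  schur_inv (schur_map (normal gl_root s)) = normal gl_root s.
Proof.
case/graph_surj=> I0 [J0 ->]; rewrite /schur_inv.
apply: (can_inj (scalerK fact_rat_neq0)); rewrite scalerKV ?fact_rat_neq0 //.
transitivity (\sum_(s : 'S_d) \sum_I \sum_J
   (if (I == place_comp s^-1%g I0) && (J == place_comp s^-1%g J0)
    then normal gl_root (graph I J) else 0)).
  rewrite [RHS]exchange_big; apply: eq_bigr => I _.
  rewrite [RHS]exchange_big; apply: eq_bigr => J _ /=.
  rewrite schur_map_normal normal_graph scaler_suml big_mkcond; apply: eq_bigr => r _.
  have -> : [forall k, I (r k) == I0 k] = (I == place_comp r^-1%g I0).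
    apply/forallP/eqP => [I_r|-> k]; last by rewrite ffunE permK.
    by apply/ffunP=> k; rewrite ffunE -(eqP (I_r _)) permKV.
  rewrite ffunE -/(place_comp r^-1%g J0) [place_comp _ J0 == _]eq_sym.
  by case: eqP; case: eqP => //= _ _; rewrite ?scale1r ?scale0r.
rewrite (eq_bigr (fun=> normal gl_root (graph I0 J0))) => [|r _].
  by rewrite sumr_const card_Sn scaler_nat.
rewrite (bigD1 (place_comp r^-1%g I0)) //= [X in _ + X]big1 ?addr0 => [|I ne_I];
  last first.
  by rewrite big1 // => J _; rewrite (negPf ne_I).
rewrite (bigD1 (place_comp r^-1%g J0)) //= [X in _ + X]big1 ?addr0 => [|J ne_J];
  last first.
  by rewrite (negPf ne_J) andbF.
rewrite !eqxx; apply: perm_normal; first exact: root_gl.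
exact: perm_graph.
Qed.

(** The elements with this property form a subspace that contains 1 and is stable under left
    multiplication by the generators, hence everything. *)
Definition recovered (q : T) := schur_inv (schur_map q) = q.

Lemma recoveredD q r : recovered q -> recovered r -> recovered (q + r).
Proof. by rewrite /recovered schur_mapD schur_invD => -> ->. Qed.

Lemma recoveredZ c q : recovered q -> recovered (c *: q).
Proof. by rewrite /recovered schur_mapZ schur_invZ => ->. Qed.

Lemma recovered0 : recovered 0.
Proof.
by rewrite /recovered -{1}(scale0r 0) schur_mapZ scale0r -(scale0r 0) schur_invZ scale0r.
Qed.

Lemma recovered_sum (J : Type) (r : seq J) (P : pred J) (G : J -> T) :
  (forall i, P i -> recovered (G i)) -> recovered (\sum_(i <- r | P i) G i).
Proof.
by move=> recG; elim/big_ind: _ => //; [apply: recovered0 | apply: recoveredD].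
Qed.

(** Descending induction on the length: [d - size s] is invertible in the rationals as long as it is
    nonzero, so (R6) expresses a short product through products one entry longer. *)
Lemma recovered_normal s : (size s <= d)%N -> recovered (normal gl_root s).
Proof.
have [m] := ubnP (d - size s); elim: m s => // m IHm s; rewrite ltnS => le_m.
rewrite leq_eqVlt => /orP[/eqP|lt_s]; first exact: schur_inv_normal.
have := sum_normal_diag (@sum_root_diag n d) s => sum_s.
have {sum_s} : normal gl_root s *+ (d - size s) = \sum_k normal gl_root ((k, k) :: s).
  by rewrite mulrnBr ?(ltnW lt_s) // -sum_s addrK.
move/(congr1 (fun q => ((d - size s)%:R : rat)^-1 *: q)).
rewrite -scaler_nat scalerK; last first.
  by rewrite Num.Theory.pnatr_eq0 subn_eq0 -ltnNge.
move=> ->; apply: recoveredZ; apply: recovered_sum => k _; apply: IHm => //=.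
lia.
Qed.

Lemma replace_sum_recovered g s : size s = d ->
  recovered (replace_sum g (normal gl_root) s).
Proof.
move=> size_s; rewrite (replace_sum_normal (@root_gl n d)) big_seq.
apply: recovered_sum => y ys; case: (g y) => [z|]; last exact: recovered0.
by apply: recovered_normal; rewrite -size_s /= size_rem //; case: (s) ys.
Qed.

Lemma presented_mulZr c (q r : T) : q * (c *: r) = c *: (q * r).
Proof. by symmetry; apply: presented_scalerAr. Qed.

Lemma presented_mulZl c (q r : T) : (c *: q) * r = c *: (q * r).
Proof. by symmetry; apply: presented_scalerAl. Qed.

(** A recovered [q] is a combination of products of length exactly [d]. Multiplying one of them on
    the left gives a product of length [d + 1], which vanishes, plus replacements, which again have
    length [d]. *)
Lemma recovered_root x q : recovered q -> recovered (gl_root x * q).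
Proof.
rewrite /recovered => rec_q; rewrite -{}rec_q -/(recovered _); move: (schur_map q) => f.
rewrite /schur_inv presented_mulZr mulr_sumr; apply: recoveredZ.
apply: recovered_sum => I _; rewrite mulr_sumr; apply: recovered_sum => J _.
rewrite presented_mulZr mul_normal; apply: recoveredZ; apply: recoveredD.
  rewrite (normal_eq0 (@presented_torsion n d) (@root_gl n d) (@sum_root_diag n d)
    (@prod_root_diag n d)); first exact: recovered0.
  by rewrite /= size_graph.
by apply: replace_sum_recovered; rewrite size_graph.
Qed.

Lemma recovered_gen g q : recovered q -> recovered (p (free_gen rat g) * q).
Proof.
case: g => [[i|i]|i].
- by rewrite -[free_gen _ _]/(gen_e i) -root_e; apply: recovered_root.
- by rewrite -[free_gen _ _]/(gen_f i) -root_f; apply: recovered_root.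
- by rewrite -[free_gen _ _]/(gen_H i) -root_diag; apply: recovered_root.
Qed.

Lemma free_monom_nil : << FMonom [::] >> = 1 :> F.
Proof. by rewrite -mpolyC1E; congr << _ >>; apply: val_inj; rewrite /= fm1. Qed.

Lemma free_monom_cons g l : << FMonom (g :: l) >> = free_gen rat g * << FMonom l >> :> F.
Proof.
rewrite malgM_def fgmulUU mulr1; congr << _ >>.
by apply: val_inj; rewrite /= fmM fmU.
Qed.

Lemma recovered_monom l q : recovered q -> recovered (p << FMonom l >> * q).
Proof.
move=> rec_q; elim: l => [|g l IHl].
  by rewrite free_monom_nil presented_class1 mul1r.
by rewrite free_monom_cons presented_classM -mulrA; apply: recovered_gen.
Qed.

Lemma recovered_mul x q : recovered q -> recovered (p x * q).
Proof.
move=> rec_q; rewrite (monalgE x) presented_class_sum mulr_suml.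
apply: recovered_sum => -[l] _.
have -> : << x@_(FMonom l) *g FMonom l >> = x@_(FMonom l) *: << FMonom l >> :> F.
  by apply/malgP=> k; rewrite mcoeffZ !mcoeffU mulr_natr.
by rewrite presented_classZ presented_mulZl; apply/recoveredZ/recovered_monom.
Qed.

Lemma schur_mapK : cancel schur_map schur_inv.
Proof.
move=> q; rewrite -/(recovered q) -[q]presented_liftK -[p _]mulr1.
(* 1 is the product of the empty sequence, whose length is at most [d]. *)
by apply: recovered_mul; apply: (@recovered_normal [::]).
Qed.

End Isomorphism.

Theorem theorem1 (n d : nat) (hn : (1 <= n)%N) (hd : (1 <= d)%N) :
  exists phi : schur_presented n d -> schur_algebra n d,
    [/\ linear phi, monoid_morphism phi & bijective phi].
Proof.
exists (@schur_map n d); split.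
- by move=> c q r; rewrite schur_mapD schur_mapZ.
- by split; [apply: schur_map1 | apply: schur_mapM].
- by exists (@schur_inv n d); [apply: schur_mapK | apply: schur_invK].
Qed.
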